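(* (Generalized min-max principle.) Let $\Gamma=(V,H)$ be an oriented hypergraph with $n$ vertices and $m$ hyperedges, in which no vertex has degree zero, and let $p\in\mathbb{R}_{>1}$. For $k=1,\ldots,n$, the constants $$\lambda_k(\Delta_p):=\inf_{S\in\mathrm{Gen}_k}\sup_{f\in S\setminus\{0\}}\mathrm{RQ}_p(f)$$ (with $\mathrm{Gen}_k$ taken in $C(V)\cong\mathbb{R}^n$) are eigenvalues of $\Delta_p$. They satisfy $\lambda_1\le\cdots\le\lambda_n$, and if $\lambda=\lambda_{k+1}=\cdots=\lambda_{k+l}$ for some $0\le k<k+l\le n$, then $\mathrm{gen}(\{\text{eigenfunctions of }\Delta_p\text{ corresponding to }\lambda\})\ge l$. The same holds for the constants $\mu_k(\Delta^H_p):=\inf_{S\in\mathrm{Gen}_k}\sup_{\gamma\in S\setminus\{0\}}\mathrm{RQ}_p(\gamma)$, $k=1,\ldots,m$ (with $\mathrm{Gen}_k$ taken in $C(H)\cong\mathbb{R}^m$), which are eigenvalues of $\Delta^H_p$.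
   Context: An oriented hypergraph $\Gamma=(V,H)$ consists of a finite vertex set $V$ and a finite set $H$ of hyperedges, each a pair $(h_{in},h_{out})$ of disjoint subsets of $V$ with nonempty union; write $h$ also for $h_{in}\cup h_{out}$. $\deg(i)$ is the number of hyperedges containing $i$ (assumed $\ge1$). Let $\mathcal{I}^h(i)=\mathcal{I}_i(h)$ be $1$ if $i\in h_{in}$, $-1$ if $i\in h_{out}$, $0$ otherwise; $\langle\mathcal{I}^h,f\rangle=\sum_{i\in h_{in}}f(i)-\sum_{j\in h_{out}}f(j)$, $\langle\mathcal{I}_i,\gamma\rangle=\sum_{h:\,i\in h_{in}}\gamma(h)-\sum_{h:\,i\in h_{out}}\gamma(h)$; $|x|^{p-2}x:=0$ at $x=0$. Vertex $p$-Laplacian: $\Delta_pf(i)=\frac{1}{\deg(i)}\sum_{h\ni i}\mathcal{I}^h(i)|\langle\mathcal{I}^h,f\rangle|^{p-2}\langle\mathcal{I}^h,f\rangle$; eigenpair: $f\ne0$, $\Delta_pf=\lambda|f|^{p-2}f$. Hyperedge $p$-Laplacian: $\Delta^H_p\gamma(h)=\sum_{i\in h}\frac{1}{\deg(i)}\mathcal{I}_i(h)|\langle\mathcal{I}_i,\gamma\rangle|^{p-2}\langle\mathcal{I}_i,\gamma\rangle$; eigenpair: $\gamma\ne0$, $\Delta^H_p\gamma=\mu|\gamma|^{p-2}\gamma$. $\mathrm{RQ}_p(f)=\frac{\sum_{h}|\langle\mathcal{I}^h,f\rangle|^p}{\sum_i\deg(i)|f(i)|^p}$, $\mathrm{RQ}_p(\gamma)=\frac{\sum_i\frac1{\deg(i)}|\langle\mathcal{I}_i,\gamma\rangle|^p}{\sum_h|\gamma(h)|^p}$.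 For a centrally symmetric set $S\subseteq\mathbb{R}^N$ ($S=-S$), its Krasnoselskii $\mathbb{Z}_2$-genus is $\mathrm{gen}(S)=\min\{k\in\mathbb{Z}_{>0}:\exists\text{ odd continuous }S\setminus\{0\}\to\mathbb{S}^{k-1}\}$ if $S\setminus\{0\}\ne\emptyset$ and $0$ otherwise; $\mathrm{Gen}_k$ is the family of centrally symmetric $S\subseteq\mathbb{R}^N$ with $\mathrm{gen}(S)\ge k$. *)

(* Defs.v *)
From mathcomp Require Import all_boot all_order all_algebra.
From mathcomp Require Import all_classical all_reals all_analysis.
Set Implicit Arguments.
Unset Strict Implicit.
Unset Printing Implicit Defensive.
Import Order.TTheory GRing.Theory Num.Theory.
Import numFieldNormedType.Exports.
Local Open Scope classical_set_scope.
Local Open Scope ring_scope.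

(* A hyperedge is the pair (h_in, h_out). *)
Record hypergraph (V : finType) := Hypergraph {
  hedges : {set {set V} * {set V}};
  hedges_disjoint : forall h, h \in hedges -> h.1 :&: h.2 = finset.set0;
  hedges_neq0 : forall h, h \in hedges -> h.1 :|: h.2 <> finset.set0 }.

Definition edge (V : finType) (G : hypergraph V) : finType :=
  {h : {set V} * {set V} | h \in hedges G}.

Definition hin (V : finType) (G : hypergraph V) (h : edge G) : {set V} :=
  (val h).1.
Definition hout (V : finType) (G : hypergraph V) (h : edge G) : {set V} :=
  (val h).2.
Definition hsupp (V : finType) (G : hypergraph V) (h : edge G) : {set V} :=
  hin h :|: hout h.

Definition deg (V : finType) (G : hypergraph V) (i : V) : nat :=
  #|[pred h : edge G | i \in hsupp h]|.

Definition incidence (R : realType) (V : finType) (G : hypergraph V)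
    (h : edge G) (i : V) : R :=
  if i \in hin h then 1 else if i \in hout h then -1 else 0.

Definition edge_pairing (R : realType) (V : finType) (G : hypergraph V)
    (h : edge G) (f : V -> R) : R :=
  \sum_(i in hin h) f i - \sum_(j in hout h) f j.

Definition vertex_pairing (R : realType) (V : finType) (G : hypergraph V)
    (i : V) (g : edge G -> R) : R :=
  \sum_(h : edge G | i \in hin h) g h - \sum_(h : edge G | i \in hout h) g h.

(* |x|^(p-2) x; it is 0 at x = 0 for every p, because of the factor x. *)
Definition spow (R : realType) (p x : R) : R := `|x| `^ (p - 2) * x.

Definition vertex_laplacian (R : realType) (V : finType) (G : hypergraph V)
    (p : R) (f : V -> R) (i : V) : R :=
  (deg G i)%:R^-1 *
  \sum_(h : edge G | i \in hsupp h) incidence R h i * spow p (edge_pairing h f).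

Definition edge_laplacian (R : realType) (V : finType) (G : hypergraph V)
    (p : R) (g : edge G -> R) (h : edge G) : R :=
  \sum_(i in hsupp h)
    (deg G i)%:R^-1 * incidence R h i * spow p (vertex_pairing i g).

Definition eigenpair (R : realType) (I : finType) (p : R)
    (L : (I -> R) -> I -> R) (lam : R) (f : I -> R) : Prop :=
  f <> 0 /\ forall i, L f i = lam * spow p (f i).

Definition eigenfunctions (R : realType) (I : finType) (p : R)
    (L : (I -> R) -> I -> R) (lam : R) : set (I -> R) :=
  [set f | eigenpair p L lam f].

Definition is_eigenvalue (R : realType) (I : finType) (p : R)
    (L : (I -> R) -> I -> R) (lam : R) : Prop :=
  exists f, eigenpair p L lam f.

Definition vertex_RQ (R : realType) (V : finType) (G : hypergraph V)
    (p : R) (f : V -> R) : R :=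
  (\sum_(h : edge G) `|edge_pairing h f| `^ p) /
  (\sum_(i : V) (deg G i)%:R * `|f i| `^ p).

Definition edge_RQ (R : realType) (V : finType) (G : hypergraph V)
    (p : R) (g : edge G -> R) : R :=
  (\sum_(i : V) (deg G i)%:R^-1 * `|vertex_pairing i g| `^ p) /
  (\sum_(h : edge G) `|g h| `^ p).

Definition centrally_symmetric (R : realType) (I : finType)
    (S : set (I -> R)) : Prop := forall f, S f -> S (- f).

(* There is an odd continuous map from S \ {0} to the Euclidean unit sphere of
   R^k.  R^I carries the product topology; values of [phi] outside S \ {0} are
   irrelevant. *)
Definition odd_map_to_sphere (R : realType) (I : finType)
    (S : set (I -> R)) (k : nat) : Prop :=
  exists phi : {ptws I -> R} -> 'rV[R]_k,
    [/\ {within (S `\ (0 : I -> R) : set {ptws I -> R}), continuous phi},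
        forall f : I -> R, (S `\ 0) f -> phi (- f) = - phi f &
        forall f : I -> R, (S `\ 0) f -> \sum_(j < k) phi f 0 j ^+ 2 = 1].

Definition is_min_sphere (R : realType) (I : finType)
    (S : set (I -> R)) (k : nat) : Prop :=
  [/\ (0 < k)%N, odd_map_to_sphere S k &
      forall j : nat, (0 < j)%N -> odd_map_to_sphere S j -> (k <= j)%N].

(* The minimum exists when S \ {0} is nonempty (lemma [is_min_sphere_genus]
   below), so the default value of [xget] is not used. *)
Definition genus (R : realType) (I : finType) (S : set (I -> R)) : nat :=
  if `[< S `\ (0 : I -> R) !=set0 >] then xget 0%N [set k | is_min_sphere S k]
  else 0%N.

Definition Gen (R : realType) (I : finType) (k : nat) : set (set (I -> R)) :=
  [set S | centrally_symmetric S /\ (k <= genus S)%N].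

Definition minmax (R : realType) (I : finType) (RQ : (I -> R) -> R) (k : nat) :
    \bar R :=
  ereal_inf [set ereal_sup [set (RQ f)%:E | f in S `\ (0 : I -> R)]
            | S in @Gen R I k].

Definition lambda_ (R : realType) (V : finType) (G : hypergraph V) (p : R)
    (k : nat) : \bar R := minmax (@vertex_RQ R V G p) k.

Definition mu_ (R : realType) (V : finType) (G : hypergraph V) (p : R)
    (k : nat) : \bar R := minmax (@edge_RQ R V G p) k.

Lemma normalized_continuous (T : topologicalType) (R : realType) (I : finType)
    (u : I -> T -> R) (f : T) :
  (forall i, {for f, continuous (u i)}) -> 0 < \sum_(i : I) u i f ^+ 2 ->
  {for f, continuous (fun g => \row_(j < #|I|)
    (u (enum_val j) g / Num.sqrt (\sum_(i : I) u i g ^+ 2)))}.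
Proof.
move=> uc u0; pose N (g : T) : R := \sum_(i : I) u i g ^+ 2.
have Nc : {for f, continuous N}.
  pose M r (g : T) : R := \sum_(i <- r) u i g ^+ 2.
  suff H (r : seq I) : M r @ f --> M r f by exact: H.
  elim: r => [|i r IH].
    have -> : M [::] = fun=> 0 by apply/funext => g; rewrite /M big_nil.
    exact: cvg_cst.
  have -> : M (i :: r) = fun g => u i g * u i g + M r g.
    by apply/funext => g; rewrite /M big_cons.
  by apply: cvgD IH; apply: cvgM; exact: uc.
apply/cvg_mx_entourageP => E entE; near=> g => a b; rewrite !mxE; move: a b.
near: g; apply: filter_forall => a; apply: filter_forall => b.
have h : (fun g => u (enum_val b) g / Num.sqrt (N g)) @ f -->
         u (enum_val b) f / Num.sqrt (N f).
  apply: cvgM; first exact: uc.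
  apply: cvgV; first by rewrite gt_eqF // sqrtr_gt0.
  by apply: continuous_comp; [exact: Nc | exact: sqrt_continuous].
move/cvg_entourageP: h => /(_ E entE) h; apply: (@filterS _ (nbhs f) _ _ _ _ h) => g /=.
by rewrite inE mxE.
Unshelve. all: by end_near. Qed.

Lemma odd_map_to_sphere_card (R : realType) (I : finType) (S : set (I -> R)) :
  odd_map_to_sphere S #|I|.
Proof.
pose N (f : {ptws I -> R}) : R := \sum_(i : I) f i ^+ 2.
have N0 (f : I -> R) : f <> 0 -> 0 < N f.
  move=> f0; rewrite lt_neqAle sumr_ge0 ?andbT; last by move=> i _; exact: sqr_ge0.
  apply/negP; rewrite eq_sym psumr_eq0; last by move=> i _; exact: sqr_ge0.
  move/allP => H; apply: f0; apply/funext => i.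
  by have := H i (mem_index_enum i); rewrite sqrf_eq0 => /eqP.
have ev (i : I) : continuous (fun f : {ptws I -> R} => f i).
  by move=> f; exact: (@proj_continuous I (fun=> R) i f).
exists (fun f : {ptws I -> R} => \row_j (f (enum_val j) / Num.sqrt (N f))); split.
- apply/continuous_in_subspaceT => f /set_mem [_ /= f0].
  apply: (@normalized_continuous _ _ _ (fun i (g : {ptws I -> R}) => g i)).
    by move=> i; exact: ev.
  exact: N0.
- move=> f _; apply/rowP => j; rewrite !mxE.
  have -> : N (- f) = N f by apply: eq_bigr => i _; rewrite /= sqrrN.
  by rewrite mulNr.
- move=> f [_ /= f0]; have Nf := N0 _ f0.
  transitivity ((\sum_(j < #|I|) f (enum_val j) ^+ 2) / N f).
    rewrite mulr_suml; apply: eq_bigr => j _.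
    by rewrite mxE exprMn exprVn sqr_sqrtr // ltW.
  rewrite (_ : \sum_(j < #|I|) _ = N f) ?divff ?gt_eqF //.
  by rewrite /N [RHS](reindex_onto (@enum_val I predT) enum_rank) /=;
     [apply: eq_bigl => j; rewrite enum_valK eqxx | move=> i _; exact: enum_rankK].
Qed.

Lemma is_min_sphere_genus (R : realType) (I : finType) (S : set (I -> R)) :
  S `\ (0 : I -> R) !=set0 -> is_min_sphere S (genus S).
Proof.
move=> S0; rewrite /genus asboolT //.
have I0 : (0 < #|I|)%N.
  case: S0 => f [_ /= f0]; rewrite lt0n; apply/eqP => /card0_eq I0.
  by apply: f0; apply/funext => i; have := I0 i.
have ex : exists k, (0 < k)%N && `[< odd_map_to_sphere S k >].
  by exists #|I|; rewrite I0; apply/asboolP; exact: odd_map_to_sphere_card.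
case: (ex_minnP ex) => k /andP[k0 /asboolP Sk] kmin.
apply: (xgetPex 0%N); exists k; split=> // j j0 Sj.
by apply: kmin; rewrite j0; apply/asboolP.
Qed.

(* Main.v *)
(* Both Rayleigh quotients have the form E/N with E and N convex, even and
   p-homogeneous.

   Finiteness of the constants needs gen(R^n) = n, that is Borsuk-Ulam, proved
   with mod 2 cochains on tuples of points of the l^1 sphere. Chains c_0, ...,
   c_(n-1) of small tuples with boundary(c_(k+1)) = c_k + (-c_k) are swept out
   by the homotopies (1 - t) x + t e_(k+1), and a hypothetical odd map
   u = (u_0, ..., u_(m-1)) without zeros gives odd sign functions s_j = [u_j > 0]
   and the cochains s_k * ds_(k-1) * ... * ds_0 (cup products). Their value on
   c_k + (-c_k) is 1 for every k < n, but 0 for k = m, because on a small tuple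
   some u_j has constant sign.

   An odd map from an arbitrary symmetric set S to a sphere can be replaced by
   an odd Lipschitz map, defined everywhere and without zeros on S \ {0}: take
   u_j = d(., {phi_j < 0}) - d(., {phi_j > 0}). So odd maps can be concatenated.

   If lam = lambda_(k+1) = ... = lambda_(k+l) and the eigenfunctions have genus
   < l, let u2 be such a map into R^(l-1) for them. On the compact set where
   u2 = 0 and |f|_1 = 1 the residual r = E' - lam N' does not vanish, so that by
   convexity one step f - t r(f), with a uniform t > 0, decreases E - lam N by a
   fixed amount; hence it moves {E/N < lam + e} into {E/N <= lam - e}, which has
   genus <= k. Composing with a map u1 into R^k for the latter and adding u2
   gives genus < k + l for {E/N < lam + e}, a contradiction. *)
Require Import Defs.
From mathcomp Require Import all_boot all_order all_algebra.
From mathcomp Require Import all_classical all_reals all_analysis.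
From mathcomp Require Import ring lra.
Set Implicit Arguments.
Unset Strict Implicit.
Unset Printing Implicit Defensive.
Import Order.TTheory GRing.Theory Num.Theory.
Import numFieldNormedType.Exports.
Local Open Scope classical_set_scope.
Local Open Scope ring_scope.

(** * Mod 2 cochains on tuples *)

Section Cochains.
Variable T : Type.
Implicit Types (F : seq T -> bool) (L : seq T) (x : T).

(** The simplicial coboundary: a sum mod 2 over the ways to omit one entry, augmented in that a
    one-entry tuple gives [F [::]]. *)
Fixpoint codiff F L : bool :=
  if L is x :: L' then F L' (+) codiff (fun M => F (x :: M)) L' else false.

(** The prism operator: a sum over the tuples that follow [f] up to some entry, repeat that entry
    under [g], and follow [g] from there on. *)
Fixpoint prism (f g : T -> T) F L : bool :=
  if L is x :: L' then
    F (f x :: g x :: map g L') (+) prism f g (fun M => F (f x :: M)) L'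
  else false.

Lemma codiffD F G L :
  codiff (fun M => F M (+) G M) L = codiff F L (+) codiff G L.
Proof.
elim: L F G => [|x L IH] F G //=.
rewrite IH; move: (F L) (G L) (codiff _ L) (codiff _ L).
by do 4!case.
Qed.

Lemma prismD f g F G L :
  prism f g (fun M => F M (+) G M) L = prism f g F L (+) prism f g G L.
Proof.
elim: L F G => [|x L IH] F G //=.
rewrite IH; move: (F (_ :: _)) (G (_ :: _)) (prism _ _ _ L) (prism _ _ _ L).
by do 4!case.
Qed.

Lemma codiff_map (f : T -> T) F L :
  codiff (fun M => F (map f M)) L = codiff F (map f L).
Proof.
by elim: L F => [|x L IH] F //=; rewrite (IH (fun M => F (f x :: M))).
Qed.

Lemma codiff_andl b F L : codiff (fun M => b && F M) L = b && codiff F L.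
Proof.
elim: L F => [|x L IH] F /=; first by rewrite andbF.
by rewrite IH; case: b {IH}.
Qed.

(** The cochain homotopy formula, by induction on [L] with the first entry absorbed into the
    cochain; repeated terms cancel mod 2. *)
Lemma prism_homotopy f g F L :
  prism f g (codiff F) L (+) codiff (prism f g F) L =
  F (map f L) (+) F (map g L).
Proof.
elim: L F => [|x L IH] F /=; first by rewrite addbb.
rewrite (prismD f g F (codiff (fun M => F (f x :: M)))).
rewrite (codiffD (fun M => F (f x :: g x :: map g M))
                 (prism f g (fun M => F (f x :: M)))).
rewrite (codiff_map g (fun M => F (f x :: g x :: M))).
have := IH (fun M => F (f x :: M)).
move: (prism f g (codiff _) L) (codiff (prism _ _ _) L) (prism f g F L).
move=> a b c; move: (codiff _ _) (F (f x :: map f L)) (F (f x :: map g L)) (F (g x :: _)).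
by case: a; case: b; case: c; do 4!case.
Qed.

Lemma prism_support f g F L :
  (forall M, size M = (size L).+1 ->
     (forall z, List.In z M -> exists2 x, List.In x L & z = f x \/ z = g x) ->
     F M = false) ->
  prism f g F L = false.
Proof.
elim: L F => [|x L IH] F //= H.
rewrite H /=; last 2 first.
- by rewrite size_map.
- move=> z [<-|[<-|]]; [by exists x; auto | by exists x; auto |].
  by move/List.in_map_iff => [y [<- yL]]; exists y; auto.
apply: IH => M sM HM; apply: H => /=; first by rewrite sM.
move=> z [<-|/HM[y yL zE]]; first by exists x; auto.
by exists y; auto.
Qed.

(* [dprod [:: a1; ..; ak]] is the cup product of the coboundaries of the
   0-cochains [ai], evaluated at [x :: L]; [theta (a :: s)] is the cup product
   of [a] with [dprod s]. *)
Fixpoint dprod (s : seq (T -> bool)) x L : bool :=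
  if s is a :: s' then
    if L is y :: L' then (a x (+) a y) && dprod s' y L' else false
  else nilp L.

Definition theta (s : seq (T -> bool)) L : bool :=
  if s is a :: s' then if L is x :: L' then a x && dprod s' x L' else false
  else false.

(** A product of coboundaries is a cocycle. As [x] stays in place here, the omissions in the tail
    add up to the one missing term, the omission of [x]. *)
Lemma codiff_dprod s x L :
  codiff (dprod s x) L = if L is y :: L' then dprod s y L' else false.
Proof.
elim: s x L => [|a s IH] x [|y L] //=.
  by case: L => [|z L] //=; elim: L => //=.
rewrite codiff_andl IH; case: L => [|z L] /=; first by rewrite andbF.
by move: (a x) (a y) (a z) (dprod _ _ _); do 4!case.
Qed.

Lemma codiff_theta a s x L :
  codiff (theta (a :: s)) (x :: L) = dprod (a :: s) x L.
Proof.
rewrite /= codiff_andl codiff_dprod.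
by case: L => [|y L] //=; [rewrite andbF | case: (a x) (a y) (dprod s y L); do 2!case].
Qed.

Lemma dprod_odd (nu : T -> T) (D : T -> Prop) s x L :
  (forall a y, List.In a s -> D y -> a (nu y) = ~~ a y) ->
  (forall y, List.In y (x :: L) -> D y) ->
  dprod s (nu x) (map nu L) = dprod s x L.
Proof.
elim: s x L => [|a s IH] x [|y L] //= sD LD.
rewrite IH; last 2 first.
- by move=> b z bs zD; apply: sD => //; right.
- by move=> z zL; apply: LD; right.
rewrite !sD; [| by left | by apply: LD; auto | by left | by apply: LD; auto].
by rewrite addbN addNb negbK.
Qed.

(** Coboundaries of odd functions are invariant under [nu], so the two terms on the right differ
    only in their first factors, which add up to 1. *)
Lemma codiff_theta_odd (nu : T -> T) (D : T -> Prop) a b s L :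
  (forall c y, List.In c [:: b, a & s] -> D y -> c (nu y) = ~~ c y) ->
  (forall y, List.In y L -> D y) ->
  codiff (theta (a :: s)) L =
  theta [:: b, a & s] L (+) theta [:: b, a & s] (map nu L).
Proof.
move=> sD; case: L => [|x L] LD //; rewrite codiff_theta.
rewrite [theta _ (x :: L)]/theta [theta _ (map _ _)]/theta /= -/dprod.
rewrite -/(dprod (a :: s) x L) -/(dprod (a :: s) (nu x) (map nu L)).
rewrite (@dprod_odd nu D (a :: s)) //; last by move=> c y cs; apply: sD; right.
rewrite sD; [| by left | by apply: LD; left].
by case: (b x); case: (dprod (a :: s) x L).
Qed.

(* A linear functional on cochains plays the role of a chain; [equator] is the
   chain [c + nu c]. *)
Variable nu : T -> T.
Hypothesis nuK : involutive nu.

Definition equator (c : (seq T -> bool) -> bool) F : bool :=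
  c F (+) c (fun L => F (map nu L)).

Variables (N : nat) (e0 : T) (h : nat -> nat -> T -> T).

(** The chain c_k as a functional. The homotopy is cut into [N] pieces, so that short steps can keep
    the tuples small. *)
Fixpoint hemisphere (k : nat) F : bool :=
  if k is k'.+1 then
    \big[addb/false]_(0 <= s < N)
      equator (hemisphere k') (prism (h k' s) (h k' s.+1) F)
  else F [:: e0].

Lemma hemisphereD k F G :
  hemisphere k (fun L => F L (+) G L) = hemisphere k F (+) hemisphere k G.
Proof.
elim: k F G => [|k IH] F G //=; rewrite -big_split /=; apply: eq_bigr => s _.
set P := prism _ _.
have -> : P (fun L => F L (+) G L) = (fun L => P F L (+) P G L).
  by apply/funext => L; exact: prismD.
by rewrite /equator IH (IH (fun L => P F (map nu L))) addbACA.
Qed.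

Lemma equatorD k F G :
  equator (hemisphere k) (fun L => F L (+) G L) =
  equator (hemisphere k) F (+) equator (hemisphere k) G.
Proof.
rewrite /equator hemisphereD.
by rewrite (hemisphereD k (fun L => F (map nu L))) addbACA.
Qed.

Lemma equator_nu k F :
  equator (hemisphere k) (fun L => F (map nu L)) = equator (hemisphere k) F.
Proof.
rewrite /equator addbC; congr (_ (+) _); congr hemisphere.
by apply/funext => L; rewrite -map_comp; congr F; rewrite -[RHS]map_id;
   apply: eq_map => x /=; exact: nuK.
Qed.

Hypothesis h0 : forall k x, h k 0 x = x.
Hypothesis hN : forall k x y, h k N x = h k N y.

(** The prisms telescope from the identity to a constant map, and at the constant end the two halves
    of the equator have equal images and cancel. *)
Lemma hemisphere_codiff k F :
  equator (hemisphere k) (codiff F) = false /\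
  hemisphere k.+1 (codiff F) = equator (hemisphere k) F.
Proof.
have step m G : (forall G, equator (hemisphere m) (codiff G) = false) ->
    hemisphere m.+1 (codiff G) = equator (hemisphere m) G.
  move=> cyc; rewrite /=.
  pose H s L := G (map (h m s) L).
  transitivity (\big[addb/false]_(0 <= s < N)
      (equator (hemisphere m) (H s) (+) equator (hemisphere m) (H s.+1))).
    apply: eq_bigr => s _; rewrite -equatorD.
    (* The cycle property supplies a vanishing term that completes the homotopy formula. *)
    rewrite -[LHS]addbF -[X in _ (+) X = _](cyc (prism (h m s) (h m s.+1) G)).
    rewrite -equatorD; congr equator; apply/funext => L.
    exact: prism_homotopy.
  have tele n : \big[addb/false]_(0 <= s < n)
      (equator (hemisphere m) (H s) (+) equator (hemisphere m) (H s.+1)) =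
      equator (hemisphere m) (H 0%N) (+) equator (hemisphere m) (H n).
    elim: n => [|n IH]; first by rewrite big_geq //; case: (equator _ _).
    rewrite big_nat_recr //= IH.
    by move: (equator _ (H _)) (equator _ (H n)) (equator _ (H n.+1)); do 3!case.
  rewrite tele.
  have -> : equator (hemisphere m) (H N) = false.
    rewrite /equator [X in _ (+) hemisphere m X](_ : _ = H N) ?addbb //.
    apply/funext => L; rewrite /H -map_comp; congr G.
    by apply: eq_map => x /=; exact: hN.
  rewrite addbF; congr equator; apply/funext => L.
  by rewrite /H; congr G; rewrite -[RHS]map_id; apply: eq_map => x; exact: h0.
have cyc : forall G, equator (hemisphere k) (codiff G) = false.
  elim: k => [|k IH] G; first by rewrite /equator /=; case: (G [::]).
  rewrite /equator step //.
  have -> : (fun L => codiff G (map nu L)) = codiff (fun L => G (map nu L)).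
    by apply/funext => L; rewrite codiff_map.
  by rewrite (step _ (fun L => G (map nu L))) // equator_nu addbb.
by split; [exact: cyc | exact: step].
Qed.

Variable supp : nat -> seq T -> Prop.
Hypothesis supp0 : supp 0 [:: e0].
Hypothesis supp_nu : forall k L, supp k L -> supp k (map nu L).
Hypothesis supp_prism : forall k s L M, (s < N)%N -> supp k L ->
  size M = (size L).+1 ->
  (forall z, List.In z M ->
     exists2 x, List.In x L & z = h k s x \/ z = h k s.+1 x) ->
  supp k.+1 M.

(** Every tuple occurring in c_k satisfies [supp k], by induction through the prisms; this is how
    geometric bounds enter the algebra. *)
Lemma hemisphere_support k F :
  (forall L, supp k L -> F L = false) -> hemisphere k F = false.
Proof.
elim: k F => [|k IH] F HF /=; first exact: HF.
rewrite big_nat_cond big1 // => s /andP[/andP[_ sN] _].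
by rewrite /equator !IH // => L Ls; apply: prism_support => M sM HM; apply: HF;
   apply: supp_prism HM => //; exact: supp_nu.
Qed.

Lemma equator_support k F :
  (forall L, supp k L -> F L = false) -> equator (hemisphere k) F = false.
Proof.
by move=> HF; rewrite /equator !hemisphere_support // => L /supp_nu/HF.
Qed.

Lemma eq_hemisphere k F G :
  (forall L, supp k L -> F L = G L) -> hemisphere k F = hemisphere k G.
Proof.
move=> FG; apply: (@addbI (hemisphere k F)); rewrite addbb -hemisphereD.
by rewrite hemisphere_support // => L /FG ->; rewrite addbb.
Qed.

Variables (D : T -> Prop) (K : nat) (s : nat -> T -> bool).
Hypothesis suppD : forall k L x, (k < K)%N -> supp k L -> List.In x L -> D x.
Hypothesis s_odd : forall k x, D x -> s k (nu x) = ~~ s k x.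

(** The latest function comes first, so [theta (countdown k.+1)] is s_k * ds_(k-1) * ... * ds_0. *)
Fixpoint countdown (k : nat) : seq (T -> bool) :=
  if k is k'.+1 then s k' :: countdown k' else [::].

Lemma equator_theta k : (k < K)%N ->
  equator (hemisphere k) (theta (countdown k.+1)) = true.
Proof.
elim: k => [|k IH] kK.
  rewrite /equator /= s_odd; first by case: (s _ _).
  by apply: (suppD kK supp0); left.
(* Stokes turns the value on the equator of c_k into that of a coboundary on c_(k+1); it remains to
   compare cochains on supported tuples. *)
rewrite -IH ?(ltnW kK) // -(hemisphere_codiff k _).2 /equator -hemisphereD.
apply: eq_hemisphere => L Ls /=.
rewrite -(@codiff_theta_odd nu D) // => [c y|y yL]; last exact: suppD kK Ls yL.
rewrite -[X in List.In _ X]/(countdown k.+2) => cs Dy.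
suff [j ->] : exists j, c = s j by exact: s_odd.
by elim: k.+2 cs => //= n IHn [<-|/IHn //]; exists n.
Qed.

Lemma dprod_constant m j x L : (j < m)%N ->
  (forall y, List.In y L -> s j y = s j x) -> dprod (countdown m) x L = false.
Proof.
elim: m x L => [|m IH] x [|y L] //=.
rewrite ltnS leq_eqVlt => /predU1P[->|jm] sL.
  by rewrite sL ?addbb //; left.
by rewrite IH ?andbF // => z zL; rewrite !sL; auto.
Qed.

End Cochains.

(** * Functions on a finite set with the l^1 norm *)

Lemma sum_continuous (T : topologicalType) (R : realType) (J : finType)
    (F : J -> T -> R) (x : T) :
  (forall j, {for x, continuous (F j)}) ->
  {for x, continuous (fun y => \sum_j F j y)}.
Proof.
move=> Fc; suff H (r : seq J) : {for x, continuous (fun y => \sum_(j <- r) F j y)}.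
  exact: H.
elim: r => [|j r IH].
  have -> : (fun y => \sum_(j <- [::]) F j y) = fun=> 0.
    by apply/funext => y; rewrite big_nil.
  exact: cvg_cst.
have -> : (fun y => \sum_(j <- j :: r) F j y) = fun y => F j y + \sum_(j <- r) F j y.
  by apply/funext => y; rewrite big_cons.
by apply: cvgD IH; exact: Fc.
Qed.

Section FunctionSpace.
Variables (R : realType) (I : finType).
Implicit Types (f g : I -> R).

Definition norm1 f : R := \sum_i `|f i|.

Lemma norm1_ge0 f : 0 <= norm1 f.
Proof. by apply: sumr_ge0. Qed.

Lemma ler_norm1 f i : `|f i| <= norm1 f.
Proof. by rewrite /norm1 (bigD1 i) //= lerDl sumr_ge0. Qed.

Lemma norm1_eq0 f : norm1 f = 0 -> f = 0.
Proof.
move=> f0; apply/funext => i; apply/normr0_eq0/eqP.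
by rewrite eq_le normr_ge0 andbT -f0 ler_norm1.
Qed.

Lemma norm1_gt0 f : f <> 0 -> 0 < norm1 f.
Proof.
by move=> f0; rewrite lt_neqAle norm1_ge0 andbT; apply/eqP => /esym/norm1_eq0.
Qed.

Lemma norm1N f : norm1 (- f) = norm1 f.
Proof. by apply: eq_bigr => i _; rewrite normrN. Qed.

Lemma norm1B f g : norm1 (f - g) = norm1 (g - f).
Proof. by rewrite -norm1N opprB. Qed.

Lemma norm1D f g : norm1 (f + g) <= norm1 f + norm1 g.
Proof. by rewrite /norm1 -big_split; apply: ler_sum => i _; exact: ler_normD. Qed.

Lemma norm1Z (a : R) f : norm1 (a *: f) = `|a| * norm1 f.
Proof. by rewrite /norm1 mulr_sumr; apply: eq_bigr => i _; rewrite normrM. Qed.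

Lemma norm1_triangle f g h : norm1 (f - h) <= norm1 (f - g) + norm1 (g - h).
Proof. by apply: le_trans (norm1D _ _); rewrite subrKA. Qed.

Lemma continuous_coord i : continuous (fun f : {ptws I -> R} => f i).
Proof. by move=> f; exact: (@proj_continuous I (fun=> R) i f). Qed.

(** The product topology is a supremum over the coordinates, so one coordinate at a time suffices,
    and each is bounded by the l^1 norm. *)
Lemma nbhs_norm1_ball f (U : set {ptws I -> R}) : nbhs (f : {ptws I -> R}) U ->
  exists2 r : R, 0 < r & forall g, norm1 (f - g) < r -> U g.
Proof.
pose B (r : R) : set {ptws I -> R} := [set g | norm1 (f - g) < r].
pose F := filter_from [set r : R | 0 < r] B.
have FF : Filter F.
  apply: filter_from_filter; first by exists 1; rewrite /= ltr01.
  move=> a b a0 b0; exists (Num.min a b); first by rewrite /= lt_min a0 b0.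
  by move=> g; rewrite /B /= lt_min => /andP[].
suff : F --> (f : {ptws I -> R}) by move=> /[apply] -[r r0 Br]; exists r.
apply/cvg_sup => i V [W] [[W' oW' <-]] Wfi WV.
have /nbhs_ballP [e /= e0 eW] : nbhs (f i) W' by exact: open_nbhs_nbhs.
exists e => // g /= fg; apply/WV/eW.
by rewrite -ball_normE /=; apply: le_lt_trans fg; exact: (ler_norm1 (f - g)).
Qed.

Lemma lipschitz_comp_continuous (T : topologicalType) (x : T) (h : T -> I -> R)
    (v : (I -> R) -> R) (C : R) :
  (forall i, {for x, continuous (fun y => h y i)}) ->
  (forall f g, `|v f - v g| <= C * norm1 (f - g)) ->
  {for x, continuous (fun y => v (h y))}.
Proof.
move=> hc vC; apply/cvgrPdist_lt => e e0.
have C0 : 0 < `|C| + 1 by rewrite ltr_wpDl.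
have d0 : 0 < e / (`|C| + 1) by rewrite divr_gt0.
have : {for x, continuous (fun y => norm1 (h x - h y))}.
  apply: sum_continuous => i.
  apply: (@cvg_norm _ R^o _ (nbhs x) _ (fun y => h x i - h y i)).
  by apply: cvgB; [exact: cvg_cst | exact: hc].
move/cvgr_lt; rewrite subrr => /(_ (e / (`|C| + 1))).
rewrite [norm1 0]big1 => [/(_ d0)|i _]; last by rewrite normr0.
apply: filterS => y; rewrite /= ltr_pdivlMr // => fg.
apply: le_lt_trans (vC _ _) (le_lt_trans _ fg).
by rewrite mulrC ler_wpM2l ?norm1_ge0 // (le_trans (ler_norm C)) // lerDl.
Qed.

Lemma lipschitz_continuous (q : {ptws I -> R} -> R) (C : R) :
  (forall f g, `|q f - q g| <= C * norm1 (f - g)) -> continuous q.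
Proof.
move=> qC f; apply: (@lipschitz_comp_continuous _ f id q C _ qC) => i.
exact: continuous_coord.
Qed.

Lemma norm1_continuous : continuous (norm1 : {ptws I -> R} -> R).
Proof.
apply: (@lipschitz_continuous _ 1) => f g; rewrite mul1r ler_norml.
apply/andP; split.
  rewrite lerNl opprB lerBlDr norm1B (le_trans _ (norm1D _ _)) //.
  by rewrite subrK.
by rewrite lerBlDr (le_trans _ (norm1D _ _)) // subrK.
Qed.

Definition sphere1 : set {ptws I -> R} := [set f | norm1 f = 1].

Lemma sphere1_neq0 f : sphere1 f -> f <> 0.
Proof.
move=> + f0; rewrite /sphere1 /= f0 /norm1 big1 => [/eqP|i _].
  by rewrite eq_sym oner_eq0.
by rewrite /= normr0.
Qed.

(** A closed subset of a cube, which is compact by Tychonoff. *)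
Lemma sphere1_compact : compact sphere1.
Proof.
apply: (@subclosed_compact _ _
    [set f : {ptws I -> R} | forall i, `[-1, 1]%classic (f i)]).
- have -> : sphere1 = (norm1 : {ptws I -> R} -> R) @^-1` [set 1] by [].
  by apply: preimage_closed; [move=> f _; exact: norm1_continuous | exact: closed_eq].
- by apply: (@tychonoff I (fun=> R) (fun=> `[-1, 1]%classic)) => i;
    exact: segment_compact.
- move=> f f1 i; rewrite /= in_itv /= -ler_norml.
  by rewrite (le_trans (ler_norm1 f i)) // f1.
Qed.

Lemma compact_positive_bound (T : topologicalType) (C : set T) (q : T -> R) :
  compact C -> continuous q -> (forall x, C x -> 0 < q x) ->
  exists2 d : R, 0 < d & forall x, C x -> d <= q x.
Proof.
move=> cC cq q0; have [C0|/set0P/negP/negPn/eqP C0] := pselect (C !=set0).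
  have [c Cc mc] := compact_EVT_min C0 cC (continuous_subspaceT cq).
  by exists (q c); [apply: q0; exact/set_mem | move=> x Cx; apply: mc; exact/mem_set].
by exists 1 => // x; rewrite C0.
Qed.

Lemma compact_upper_bound (T : topologicalType) (C : set T) (q : T -> R) :
  compact C -> continuous q ->
  exists2 M : R, 0 < M & forall x, C x -> q x <= M.
Proof.
move=> cC cq; have [C0|/set0P/negP/negPn/eqP C0] := pselect (C !=set0).
  have [c Cc mc] := compact_EVT_max C0 cC (continuous_subspaceT cq).
  exists (`|q c| + 1); first by rewrite ltr_wpDl.
  move=> x Cx; rewrite (le_trans (mc x (mem_set Cx))) // (le_trans (ler_norm _)) //.
  by rewrite lerDl.
by exists 1 => // x; rewrite C0.
Qed.

(** A tube argument: positivity at parameter 0 persists near each point for small parameters, and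
    compactness makes the smallness uniform. *)
Lemma compact_uniform_step (T : topologicalType) (C : set T) (q : T * R -> R) :
  compact C -> continuous q -> (forall x, C x -> 0 < q (x, 0)) ->
  exists2 t : R, 0 < t & forall x, C x -> 0 < q (x, t).
Proof.
move=> /compact_near_coveringP cC cq q0.
have : \forall t \near (0 : R), C `<=` [set x | 0 < q (x, t)].
  apply: (cC R (nbhs (0 : R)) (fun t x => 0 < q (x, t))) => x Cx.
  have /cvgr_gt/(_ _ (q0 x Cx)) := cq (x, 0).
  by apply: filterS => -[].
move=> /nbhs_ballP[r /= r0 rC]; exists (r / 2); first by rewrite divr_gt0.
apply: rC; rewrite -ball_normE /= sub0r normrN gtr0_norm ?divr_gt0 //.
by rewrite ltr_pdivrMr // ltr_pMr // ltr1n.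
Qed.

End FunctionSpace.

(** * The Borsuk-Ulam theorem *)

Section BorsukUlam.
Variables (R : realType) (I : finType) (m : nat) (u : nat -> (I -> R) -> R).
Variable C : R.
Hypothesis C_ge0 : 0 <= C.
Hypothesis u_lip : forall j f g, `|u j f - u j g| <= C * norm1 (f - g).
Hypothesis u_odd : forall j f, u j (- f) = - u j f.
Hypothesis u_neq0 : forall f, norm1 f = 1 -> exists2 j, (j < m)%N & u j f != 0.

(** A tie-break for the zeros of [u j]. The picked index depends only on which functions vanish,
    hence is the same at [f] and [- f], and [sgn j] is odd on the whole sphere. *)
Let first_sign (f : I -> R) : bool :=
  if [pick j : 'I_m | u j f != 0] is Some j then 0 < u j f else false.

Let sgn (j : nat) (f : I -> R) : bool :=
  if u j f == 0 then first_sign f else 0 < u j f.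

Let sgnN j f : norm1 f = 1 -> sgn j (- f) = ~~ sgn j f.
Proof.
have ltN (x : R) : x != 0 -> (0 < - x) = ~~ (0 < x).
  by move=> x0; rewrite oppr_gt0 -leNgt le_eqVlt (negbTE x0).
move=> f1; rewrite /sgn u_odd oppr_eq0.
case: ifPn => [_|/ltN //]; rewrite /first_sign.
rewrite (eq_pick (Q := [pred j : 'I_m | u j f != 0])) => [|i /=]; last first.
  by rewrite u_odd oppr_eq0.
case: pickP => [i /= ui|n0]; first by rewrite u_odd ltN.
by have [i im] := u_neq0 f1; have /= -> := n0 (Ordinal im).
Qed.

Let axis (k : nat) : I -> R := fun i => (enum_rank i == k :> nat)%:R.

Let norm1_axis k : (k < #|I|)%N -> norm1 (axis k) = 1.
Proof.
move=> kI; rewrite /norm1 (bigD1 (enum_val (Ordinal kI))) //= big1 => [|i].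
  by rewrite /axis enum_valK eqxx normr1 addr0.
move=> ik; rewrite /axis; case: eqP => [ek|]; last by rewrite normr0.
by case/eqP: ik; apply: enum_rank_inj; rewrite enum_valK; apply: val_inj.
Qed.

(** * Small tuples on the l^1 sphere *)

Section Homotopy.
Variable N : nat.
Hypothesis N_gt0 : (0 < N)%N.

Let h (k s : nat) (f : I -> R) : I -> R :=
  (1 - s%:R / N%:R) *: f + (s%:R / N%:R) *: axis k.+1.

Let N0 : N%:R != 0 :> R. Proof. by rewrite pnatr_eq0 -lt0n. Qed.

(** The guard is there because [axis k] is zero from [#|I|] on. Each dimension adds 2/N to the
    diameter bound, and the vanishing coordinates leave the next axis free. *)
Let supp (k : nat) (L : seq (I -> R)) : Prop := (k < #|I|)%N ->
  [/\ size L = k.+1,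
      forall f, List.In f L -> norm1 f = 1 /\
        forall i, (k < enum_rank i)%N -> f i = 0 &
      forall f g, List.In f L -> List.In g L ->
        norm1 (f - g) <= k%:R * 2 / N%:R].

Let h_itv s : (s <= N)%N -> 0 <= s%:R / N%:R :> R /\ 0 <= 1 - s%:R / N%:R :> R.
Proof.
move=> sN; split; first by rewrite divr_ge0.
by rewrite subr_ge0 ler_pdivrMr ?ltr0n // mul1r ler_nat.
Qed.

(** [f] and [axis k.+1] have disjoint supports, so their l^1 norms add: the straight homotopy stays
    on the sphere without rescaling. *)
Let h_norm1 k s f : (s <= N)%N -> (k.+1 < #|I|)%N -> norm1 f = 1 ->
  (forall i, (k < enum_rank i)%N -> f i = 0) -> norm1 (h k s f) = 1.
Proof.
move=> sN kI f1 f0; have [t0 t1] := h_itv sN.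
pose t : R := s%:R / N%:R.
transitivity ((1 - t) * norm1 f + t * norm1 (axis k.+1)); last first.
  by rewrite f1 norm1_axis // !mulr1 subrK.
rewrite /norm1 !mulr_sumr -big_split /=; apply: eq_bigr => i _.
rewrite /h /axis -[X in `|X|]/((1 - t) * f i + t * (enum_rank i == k.+1 :> nat)%:R).
case: eqP => [ik|_]; last by rewrite normr0 !mulr0 !addr0 normrM (ger0_norm t1).
by rewrite f0 ?ik // normr0 !mulr0 !add0r normr1 !mulr1 ger0_norm.
Qed.

Let supp_prism k s L M : (s < N)%N -> supp k L -> size M = (size L).+1 ->
  (forall z, List.In z M ->
     exists2 x, List.In x L & z = h k s x \/ z = h k s.+1 x) ->
  supp k.+1 M.
Proof.
move=> sN LS sM ML kI; have [sL L1 L2] := LS (ltnW kI).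
have hs z : List.In z M ->
  exists x t, [/\ List.In x L, z = h k t x, (t <= N)%N & t = s \/ t = s.+1].
  case/ML => x xL [->|->]; [exists x, s | exists x, s.+1]; split=> //.
  - exact: ltnW.
  - by left.
  - by right.
have hdist1 t x y : (t <= N)%N -> List.In x L -> List.In y L ->
    norm1 (h k t x - h k t y) <= k%:R * 2 / N%:R.
  move=> tN xL yL; have [t0 t1] := h_itv tN.
  have -> : h k t x - h k t y = (1 - t%:R / N%:R) *: (x - y).
    by rewrite /h scalerBr opprD addrACA subrr addr0.
  rewrite norm1Z ger0_norm // (le_trans _ (L2 x y xL yL)) //.
  by rewrite ler_piMl ?norm1_ge0 // lerBlDr lerDl.
have hdist2 x : List.In x L -> norm1 (h k s x - h k s.+1 x) <= 2 / N%:R.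
  move=> xL; have -> : h k s x - h k s.+1 x = N%:R^-1 *: (x - axis k.+1).
    apply/funext => i; rewrite /h.
    rewrite -[LHS]/((1 - s%:R / N%:R) * x i + (s%:R / N%:R) * axis k.+1 i -
      ((1 - s.+1%:R / N%:R) * x i + (s.+1%:R / N%:R) * axis k.+1 i)).
    rewrite -[RHS]/(N%:R^-1 * (x i - axis k.+1 i)) -natr1.
    by field.
  rewrite norm1Z ger0_norm ?invr_ge0 // mulrC ler_wpM2r ?invr_ge0 //.
  apply: le_trans (norm1D _ _) _; rewrite norm1N norm1_axis //.
  by have [-> _] := L1 _ xL.
split.
- by rewrite sM sL.
- move=> _ /hs[x [t [xL -> tN _]]]; have [x1 x0] := L1 _ xL.
  split; first exact: h_norm1.
  move=> i ki; rewrite /h /axis.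
  rewrite -[LHS]/(_ * x i + _ * _%:R) x0 ?(ltnW ki) // gtn_eqF //.
  by rewrite !mulr0 addr0.
- move=> _ _ /hs[x [t [xL -> tN tE]]] /hs[y [t' [yL -> tN' tE']]].
  have -> : k.+1%:R * 2 / N%:R = k%:R * 2 / N%:R + 2 / N%:R :> R.
    by rewrite -natr1; field.
  have n0 : 0 <= 2 / N%:R :> R by rewrite divr_ge0.
  have [->|tt'] := eqVneq t t'.
    by apply: le_trans (hdist1 _ _ _ tN' xL yL) _; rewrite lerDl.
  apply: le_trans (norm1_triangle _ (h k t y) _) _.
  apply: lerD (hdist1 _ _ _ tN xL yL) _.
  case: tE tE' tt' => -> [] ->; rewrite ?eqxx // => _; first exact: hdist2.
  by rewrite norm1B; exact: hdist2.
Qed.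

Let supp0 : supp 0 [:: axis 0].
Proof.
move=> I0; split=> [|f [<-|//]|f g [<-|//] [<-|//]] //.
  split; first exact: norm1_axis.
  by move=> i i0; rewrite /axis gtn_eqF.
by rewrite subrr mul0r mul0r /norm1 big1 // => i _; rewrite normr0.
Qed.

Let supp_opp k L : supp k L -> supp k (map -%R L).
Proof.
move=> Ls kI; have [sL L1 L2] := Ls kI; split; first by rewrite size_map.
  move=> _ /List.in_map_iff[f [<- /L1[f1 f0]]]; rewrite norm1N; split=> //.
  by move=> i /f0 fi; rewrite -[LHS]/(- f i) fi oppr0.
move=> _ _ /List.in_map_iff[f [<- fL]] /List.in_map_iff[g [<- gL]].
by rewrite -opprD norm1N L2.
Qed.

(** Otherwise the cochain would vanish on all supported tuples, hence on the equator, where its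
    value is 1. *)
Lemma small_alternating_simplex (k : nat) : (k < #|I|)%N ->
  exists L : seq (I -> R), [/\ size L = k.+1,
    forall f, List.In f L -> norm1 f = 1,
    forall f g, List.In f L -> List.In g L -> norm1 (f - g) <= k%:R * 2 / N%:R &
    theta (countdown sgn k.+1) L].
Proof.
move=> kI; apply: contrapT => nL.
suff: equator (fun f : I -> R => - f)
    (hemisphere (fun f : I -> R => - f) N (axis 0) h k) (theta (countdown sgn k.+1)).
  rewrite (@equator_support _ _ _ _ _ supp) //.
  - move=> L /(_ kI)[sL L1 L2]; apply/negbTE/negP => tL; apply: nL; exists L.
    by split=> // f /L1[].
apply: (@equator_theta _ _ _ _ _ _ _ _ supp _ _ _ (fun f => norm1 f = 1) #|I|) => //.
- exact: opprK.
- by move=> j f; rewrite /h mul0r subr0 scale1r scale0r addr0.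
- by move=> j f g; rewrite /h divff // subrr !scale0r.
- by move=> j L f jI /(_ jI)[_ L1 _] /L1[].
Qed.
End Homotopy.

Theorem borsuk_ulam : (#|I| <= m)%N.
Proof.
rewrite leqNgt; apply/negP => mI.
pose M (f : {ptws I -> R}) : R := \sum_(j < m) `|u j f|.
have Mc : continuous M.
  apply: (@lipschitz_continuous _ _ _ (m%:R * C)) => f g.
  rewrite /M -sumrB; apply: le_trans (ler_norm_sum _ _ _) _.
  have -> : m%:R * C * norm1 (f - g) = \sum_(j < m) C * norm1 (f - g).
    by rewrite sumr_const card_ord mulr_natl mulrnAl.
  apply: ler_sum => j _; apply: le_trans (u_lip _ _ _).
  exact: ler_dist_dist.
have [f f1|d d0 dM] := @compact_positive_bound R _ _ M (@sphere1_compact R I) Mc.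
  have [j jm uj] := u_neq0 f1.
  rewrite /M (bigD1 (Ordinal jm)) //= ltr_pwDl ?normr_gt0 // sumr_ge0 //.
pose b (N : nat) : R := C * (m%:R * 2 / N%:R).
(* A supported tuple of dimension [m] has diameter at most 2m/N, so each [u j] varies on it by at
   most [b N]; this [N] brings [m * b N] below the minimum [d] of [M]. *)
pose N := (Num.bound (m%:R * (C * (m%:R * 2)) / d)).+1.
have bN : m%:R * b N < d.
  have -> : m%:R * b N = m%:R * (C * (m%:R * 2)) / N%:R by rewrite /b !mulrA.
  rewrite ltr_pdivrMr ?ltr0n // [ltRHS]mulrC -ltr_pdivrMr //.
  apply: lt_le_trans (archi_boundP _) _; last by rewrite ler_nat.
  by apply: divr_ge0; [do !apply: mulr_ge0 | exact: ltW].
have [[|x L] [//= _ L1 L2]] := small_alternating_simplex (ltn0Sn _ : 0 < N)%N mI.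
(* The factor [sgn m x] is dropped; the rest contains the coboundary of [sgn j] for each [j < m],
   and one of these vanishes. *)
case/andP => _; apply/negP; rewrite -eqbF_neg; apply/eqP.
have /dM Mx : sphere1 x by apply: L1; left.
have [j jx] : exists j : 'I_m, b N < `|u j x|.
  apply: contrapT => /forallNP H; move: bN; apply/negP; rewrite -leNgt.
  apply: le_trans Mx _; rewrite /M mulr_natl -[m in _ *+ m]card_ord -sumr_const.
  by apply: ler_sum => j _; rewrite leNgt; apply/negP/H.
apply: (@dprod_constant _ sgn m j) => // y yL.
have uxy : `|u j x - u j y| < `|u j x|.
  apply: le_lt_trans jx; apply: le_trans (u_lip _ _ _) _.
  by rewrite ler_wpM2l // L2 //; [left | right].
have ux : u j x != 0 by apply: contraTneq uxy => ->; rewrite normr0 ltNge normr_ge0.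
have uy : u j y != 0 by apply: contraTneq uxy => ->; rewrite subr0 ltxx.
rewrite /sgn (negbTE ux) (negbTE uy); move: uxy.
have [ux0|ux0] := ltrP 0 (u j x).
  by rewrite (gtr0_norm ux0) ltr_norml => /andP[_]; rewrite gtrBl.
rewrite (ler0_norm ux0) ltr_norml opprK => /andP[+ _].
by rewrite ltrBDr gtrDl => uy0; apply: lt_gtF.
Qed.
End BorsukUlam.

(** * Genus and odd Lipschitz maps *)

Section Genus.
Variables (R : realType) (I : finType).
Implicit Types (f g : I -> R) (S A : set (I -> R)).

(** For empty [A] the value is 0, so the Lipschitz bound holds for every [A]. *)
Definition dist1 A f : R := inf [set norm1 (f - g) | g in A].

Lemma norm1_0 : norm1 (0 : I -> R) = 0.
Proof. by rewrite /norm1 big1 // => i _; rewrite normr0. Qed.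

Let dist_lb A f : has_lbound [set norm1 (f - g) | g in A].
Proof. by exists 0 => _ [g _ <-]; exact: norm1_ge0. Qed.

Let dist1_empty A f : ~ (A !=set0) -> dist1 A f = 0.
Proof.
move=> nA; rewrite /dist1 (_ : [set _ | _ in A] = set0) ?inf0 //.
by rewrite -subset0 => x [g Ag _]; apply: nA; exists g.
Qed.

Lemma dist1_ge0 A f : 0 <= dist1 A f.
Proof.
have [[g Ag]|nA] := pselect (A !=set0).
  apply: lb_le_inf; first by exists (norm1 (f - g)), g.
  by move=> _ [h _ <-]; exact: norm1_ge0.
by rewrite dist1_empty.
Qed.

Lemma dist1_eq0 A f : A f -> dist1 A f = 0.
Proof.
move=> Af; apply/eqP; rewrite eq_le dist1_ge0 andbT -norm1_0 -(subrr f).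
by apply: ge_inf => //; exists f.
Qed.

Lemma dist1_lipschitz A f g : `|dist1 A f - dist1 A g| <= norm1 (f - g).
Proof.
have [[a Aa]|nA] := pselect (A !=set0); last first.
  by rewrite !dist1_empty // subrr normr0 norm1_ge0.
have H f' g' : dist1 A f' - dist1 A g' <= norm1 (f' - g').
  rewrite lerBlDr -lerBlDl; apply: lb_le_inf; first by exists (norm1 (g' - a)), a.
  move=> _ [h Ah <-]; rewrite lerBlDl.
  apply: le_trans (norm1_triangle _ g' _).
  by apply: ge_inf => //; exists h.
by rewrite ler_norml H lerNl opprB norm1B H.
Qed.

Lemma dist1_opp A B f : (forall g, A g <-> B (- g)) -> dist1 A (- f) = dist1 B f.
Proof.
move=> AB; rewrite /dist1; congr inf; apply/seteqP; split=> _ [g Hg <-].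
  by exists (- g); [exact/AB | rewrite -norm1N opprB addrC].
by exists (- g); [apply/AB; rewrite opprK | rewrite -norm1N opprB opprK addrC].
Qed.

(* The extension does not agree with the given map on [S]: it only keeps, at
   each point, the signs of its nonzero coordinates. *)
Lemma odd_map_extension S m : centrally_symmetric S -> odd_map_to_sphere S m ->
  exists u : nat -> (I -> R) -> R,
    [/\ forall j f g, `|u j f - u j g| <= 2 * norm1 (f - g),
        forall j f, u j (- f) = - u j f &
        forall f, S f -> f <> 0 -> exists2 j, (j < m)%N & u j f != 0].
Proof.
move=> Ssym [phi [phic phiN phi1]].
(* From index [m] on the value is 0, so that [P j] and [Q j] are empty and [u j] below vanishes. *)
pose c j f : R := if insub j is Some i then phi f 0 i else 0.
pose P j := [set f | (S `\ (0 : I -> R)) f /\ 0 < c j f].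
pose Q j := [set f | (S `\ (0 : I -> R)) f /\ c j f < 0].
have SN f : (S `\ (0 : I -> R)) f -> (S `\ (0 : I -> R)) (- f).
  by case=> Sf f0; split; [exact: Ssym | move=> /= /eqP; rewrite oppr_eq0 => /eqP].
have cN j f : (S `\ (0 : I -> R)) f -> c j (- f) = - c j f.
  move=> Sf; rewrite /c; case: insubP => [i _ _|_]; last by rewrite oppr0.
  by rewrite phiN // mxE.
have PQ j f : P j f <-> Q j (- f).
  split=> -[Sf cf]; split; rewrite ?cN ?oppr_lt0 //; first exact: SN.
    by rewrite -[f]opprK; exact: SN.
  move: cf; have : (S `\ (0 : I -> R)) f by rewrite -[f]opprK; exact: SN.
  by move=> /cN ->; rewrite oppr_lt0.
pose u j f := dist1 (Q j) f - dist1 (P j) f.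
have uN j f : u j (- f) = - u j f.
  rewrite /u (dist1_opp _ (PQ j)) (dist1_opp (B := P j)) ?opprB // => g.
  by rewrite PQ opprK.
exists u; split=> //.
  move=> j f g; have -> : u j f - u j g =
      (dist1 (Q j) f - dist1 (Q j) g) - (dist1 (P j) f - dist1 (P j) g).
    by rewrite /u; ring.
  apply: le_trans (ler_normB _ _) _; rewrite mulr2n mulrDl mul1r.
  by apply: lerD; exact: dist1_lipschitz.
have pos f j : (S `\ (0 : I -> R)) f -> 0 < c j f -> u j f != 0.
  move=> Sf cf; rewrite /u (dist1_eq0 (A := P j)) // subr0.
  move: (cf); rewrite {1}/c; case: insubP => [i _ ij cfi|]; last by rewrite ltxx.
  have /subspace_continuousP/(_ f Sf) phif := phic.
  have /nbhs_norm1_ball[r r0 rP] : nbhs (f : {ptws I -> R})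
      [set g | (S `\ (0 : I -> R)) g -> 0 < phi g 0 i].
    pose F := within (S `\ (0 : I -> R)) (nbhs (f : {ptws I -> R})).
    have FF : Filter F 
      by exact: (@within_filter _ _ _ (nbhs_filter (f : {ptws I -> R}))).
    have : (fun g => phi g 0 i) @ F --> phi f 0 i.
      apply: (@cvg_comp _ _ _ phi (fun M : 'rV[R]_m => M 0 i) F _ _ phif).
      exact: coord_continuous.
    by move/cvgr_gt => /(_ _ cfi).
  (* The ball around [f] misses [Q j]; nonemptiness of [Q j] is what makes the distance positive,
     since it is 0 for the empty set. *)
  have NQ : Q j (- f) by apply/PQ.
  rewrite gt_eqF // (lt_le_trans r0) // lb_le_inf //.
    by exists (norm1 (f - - f)), (- f).
  move=> _ [g [Sg cg] <-]; rewrite leNgt; apply/negP => /rP/(_ Sg).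
  by move: cg; rewrite /c -ij valK => /lt_gtF ->.
move=> f Sf f0; have Sf0 : (S `\ (0 : I -> R)) f by [].
have [j pj] : exists j, phi f 0 j != 0.
  apply: contrapT => /forallNP H; have := phi1 f Sf0.
  rewrite big1 => [/eqP|j _]; first by rewrite eq_sym oner_eq0.
  by have /negP/negPn/eqP -> := H j; rewrite expr0n.
exists j => //; have cj : c j f = phi f 0 j.
  by rewrite /c insubT //= => jm; congr (phi f 0 _); apply: val_inj.
have [cf|cf] := ltrP 0 (c j f); first exact: pos.
rewrite -oppr_eq0 -uN; apply: pos; first exact: SN.
by rewrite cN // oppr_gt0 lt_neqAle cf andbT cj.
Qed.

(** Dividing by the Euclidean norm of the first [m] functions gives an odd map to the sphere.
    Continuity is asked off 0 because the lemma is applied to maps that involve [normalize]. *)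
Lemma genus_le S m (u : nat -> {ptws I -> R} -> R) :
  (forall j f, f <> 0 -> {for f, continuous (u j)}) ->
  (forall j f, u j (- f) = - u j f) ->
  (forall f, S f -> f <> 0 -> exists2 j, (j < m)%N & u j f != 0) ->
  (genus S <= m)%N.
Proof.
move=> uc uN u0.
have [S0|nS] := pselect (S `\ (0 : I -> R) !=set0); last first.
  by rewrite /genus asboolF.
have [_ _] := is_min_sphere_genus S0; apply.
  by case: S0 => f [Sf f0]; have [j jm _] := u0 f Sf f0; exact: leq_ltn_trans jm.
rewrite -[m]card_ord.
pose N (f : {ptws I -> R}) : R := \sum_(i : 'I_m) u i f ^+ 2.
have N0 f : S f -> f <> 0 -> 0 < N f.
  move=> Sf /(u0 _ Sf)[j jm uj]; rewrite /N (bigD1 (Ordinal jm)) //=.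
  by rewrite ltr_pwDl ?sumr_ge0 // => [|i _]; rewrite ?sqr_ge0 // exprn_even_gt0.
exists (fun f : {ptws I -> R} => \row_j (u (enum_val j : 'I_m) f / Num.sqrt (N f))).
split.
- apply/continuous_in_subspaceT => f /set_mem [Sf /= f0].
  apply: (@normalized_continuous _ _ 'I_m (fun i (g : {ptws I -> R}) => u i g)).
    by move=> i; exact: uc.
  exact: N0.
- move=> f _; apply/rowP => j; rewrite !mxE uN.
  have -> : N (- f) = N f by apply: eq_bigr => i _; rewrite uN sqrrN.
  by rewrite mulNr.
- move=> f [Sf /= f0]; have Nf := N0 _ Sf f0.
  transitivity ((\sum_(j < #|'I_m|) u (enum_val j : 'I_m) f ^+ 2) / N f).
    rewrite mulr_suml; apply: eq_bigr => j _.
    by rewrite mxE exprMn exprVn sqr_sqrtr // ltW.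
  rewrite (_ : \sum_(j < #|'I_m|) _ = N f) ?divff ?gt_eqF //.
  rewrite /N [RHS](reindex_onto (@enum_val 'I_m predT) enum_rank) /=.
    by apply: eq_bigl => j; rewrite enum_valK eqxx.
  by move=> i _; exact: enum_rankK.
Qed.

(** Families indexed by all natural numbers can be concatenated by a shift. If [S] has no nonzero
    point, zero functions serve. *)
Lemma genus_extension S m : centrally_symmetric S -> (genus S <= m)%N ->
  exists u : nat -> (I -> R) -> R,
    [/\ forall j f g, `|u j f - u j g| <= 2 * norm1 (f - g),
        forall j f, u j (- f) = - u j f &
        forall f, S f -> f <> 0 -> exists2 j, (j < m)%N & u j f != 0].
Proof.
move=> Ssym Sm; have [S0|nS] := pselect (S `\ (0 : I -> R) !=set0).
  have [_ /(odd_map_extension Ssym)[u [ul uN u0]] _] := is_min_sphere_genus S0.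
  exists u; split=> // f Sf /(u0 f Sf)[j jS uj].
  by exists j => //; exact: leq_trans Sm.
exists (fun _ _ => 0); split=> [j f g|j f|f Sf f0].
- by rewrite subrr normr0 mulr_ge0 ?norm1_ge0.
- by rewrite oppr0.
- by case: nS; exists f.
Qed.

(** The family obtained for the whole space has no common zero on the sphere, so Borsuk-Ulam applies
    to it. *)
Lemma card_le_genus_setT : (#|I| <= genus [set: I -> R])%N.
Proof.
have [//|u [ul uN u0]] := @genus_extension [set: I -> R] _ _ (leqnn _).
apply: (borsuk_ulam (ler0n _ 2) ul uN) => f f1.
by apply: u0 => //; exact: sphere1_neq0.
Qed.

End Genus.

(** * The signed power *)

Section SignedPower.
Variables (R : realType) (p : R).
Hypothesis p_gt1 : 1 < p.
Implicit Types x y : R.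

Let p0 : p != 0. Proof. by rewrite gt_eqF // (lt_trans ltr01). Qed.

Lemma spow0 : spow p (0 : R) = 0.
Proof. by rewrite /spow mulr0. Qed.

Lemma spowN x : spow p (- x) = - spow p x.
Proof. by rewrite /spow normrN mulrN. Qed.

Lemma spowE x : 0 < x -> spow p x = x `^ (p - 1).
Proof.
move=> x0; rewrite /spow gtr0_norm // -{2}(powRr1 (ltW x0)) -powRD.
  by congr (_ `^ _); ring.
by apply/implyP => _; rewrite gt_eqF.
Qed.

Lemma normr_spow x : `|spow p x| = `|x| `^ (p - 1).
Proof.
have [x0|x0|->] := ltrgt0P x.
- by rewrite spowE // ger0_norm ?powR_ge0.
- by rewrite -normrN -spowN spowE ?oppr_gt0 // ger0_norm ?powR_ge0.
- by rewrite spow0 normr0 powR0 // subr_eq0 gt_eqF.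
Qed.

Lemma spow_mulr x : spow p x * x = `|x| `^ p.
Proof.
have pos y : 0 < y -> spow p y * y = `|y| `^ p.
  move=> y0; rewrite spowE // gtr0_norm // -{2}(powRr1 (ltW y0)) -powRD.
    by congr (_ `^ _); ring.
  by apply/implyP => _; rewrite gt_eqF.
have [x0|x0|->] := ltrgt0P x; last by rewrite mulr0 powR0.
  by rewrite pos // gtr0_norm.
by rewrite -[x]opprK spowN mulrNN pos ?oppr_gt0 // normrN ltr0_norm // opprK.
Qed.

(** Convexity of |.|^p, in the form of Young's inequality for |y| and |x|^(p-1) with exponents p and
    p/(p-1). *)
Lemma spow_tangent x y :
  `|x| `^ p + p * spow p x * (y - x) <= `|y| `^ p.
Proof.
have q0 : 0 < p - 1 by rewrite subr_gt0.
have pp : 0 < p by exact: lt_trans ltr01 _.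
have Y := @conjugate_powR R `|y| (`|x| `^ (p - 1)) p (p / (p - 1))
  (normr_ge0 _) (powR_ge0 _ _) pp (divr_gt0 pp q0).
have : p^-1 + (p / (p - 1))^-1 = 1 by field; rewrite p0 gt_eqF.
move/Y => {Y}; rewrite -powRrM (_ : (p - 1) * (p / (p - 1)) = p); last first.
  by field; rewrite gt_eqF.
rewrite -normr_spow -normrM => Y.
have {Y} : p * (y * spow p x) <= `|y| `^ p + (p - 1) * `|x| `^ p.
  rewrite (_ : _ + _ = p * (`|y| `^ p / p + `|x| `^ p / (p / (p - 1)))).
    by rewrite ler_pM2l // (le_trans (ler_norm _) Y).
  by field; rewrite p0 gt_eqF.
rewrite mulrBr -[p * spow p x * x]mulrA spow_mulr; lra.
Qed.

Lemma spow_continuous : continuous (spow p : R -> R).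
Proof.
have q0 : 0 < p - 1 by rewrite subr_gt0.
have pos x : 0 < x -> {for x, continuous (spow p : R -> R)}.
  move=> x0; have ec : {for x, continuous (fun y : R => expR ((p - 1) * ln y))}.
    apply: (@continuous_comp _ _ _ (fun y : R => (p - 1) * ln y) expR).
      by apply: cvgM; [exact: cvg_cst | exact: continuous_ln].
    exact: continuous_expR.
  have E (y : R) : 0 < y -> expR ((p - 1) * ln y) = spow p y.
    by move=> y0; rewrite spowE // /powR gt_eqF.
  rewrite /prop_for /continuous_at -(E x x0).
  apply: cvg_trans ec; apply: near_eq_cvg.
  near=> y; apply/E; near: y; exact: lt_nbhsr.
move=> x; have [x0|x0|->] := ltrgt0P x.
- exact: pos.
- have -> : (spow p : R -> R) = fun y => - spow p (- y).
    by apply/funext => y; rewrite spowN opprK.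
  apply: cvgN; apply: (@continuous_comp _ _ _ (fun y : R => - y) (spow p : R -> R)).
    exact: opp_continuous.
  by apply: pos; rewrite oppr_gt0.
apply/cvgrPdist_lt => e e0; rewrite spow0.
(* The radius at which |y|^(p-1), the absolute value of [spow p y], reaches [e]. *)
have d0 : 0 < e `^ (p - 1)^-1 by exact: powR_gt0.
have : \forall y \near (0 : R), `|y| < e `^ (p - 1)^-1 by exact: nbhs0_lt.
apply: filterS => y yd; rewrite sub0r normrN normr_spow.
have -> : e = (e `^ (p - 1)^-1) `^ (p - 1).
  by rewrite -powRrM mulVf ?powRr1 ?gt_eqF // ltW.
by rewrite gt0_ltr_powR // ?nnegrE ?powR_ge0.
Unshelve. all: by end_near. Qed.

Lemma normr_powR_continuous : continuous (fun x : R => `|x| `^ p).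
Proof.
have -> : (fun x : R => `|x| `^ p) = fun x => spow p x * x.
  by apply/funext => x; rewrite spow_mulr.
by move=> x; apply: cvgM; [exact: spow_continuous | exact: cvg_id].
Qed.

End SignedPower.

(** * The min-max principle for abstract energies *)

Section MinMax.
Variables (R : realType) (I J : finType) (p : R).
Variables (A : J -> I -> R) (a : J -> R) (w : I -> R).
Hypothesis p_gt1 : 1 < p.
Hypothesis a_ge0 : forall j, 0 <= a j.
Hypothesis w_gt0 : forall i, 0 < w i.
Implicit Types f g : I -> R.

Definition pairing j f : R := \sum_i A j i * f i.
Definition energy f : R := \sum_j a j * `|pairing j f| `^ p.
Definition mass f : R := \sum_i w i * `|f i| `^ p.
Definition rayleigh f : R := energy f / mass f.
(** The partial derivative of [energy] in coordinate [i], divided by [p]. *)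
Definition gradient i f : R := \sum_j a j * A j i * spow p (pairing j f).
Definition laplacian f i : R := (w i)^-1 * gradient i f.

Let p_gt0 : 0 < p. Proof. exact: lt_trans ltr01 _. Qed.

Lemma pairingZ j (t : R) f : pairing j (t *: f) = t * pairing j f.
Proof.
rewrite /pairing mulr_sumr; apply: eq_bigr => i _.
by rewrite mulrCA.
Qed.

Lemma pairingN j f : pairing j (- f) = - pairing j f.
Proof. by rewrite -scaleN1r pairingZ mulN1r. Qed.

Lemma gradientN i f : gradient i (- f) = - gradient i f.
Proof.
by rewrite /gradient -sumrN; apply: eq_bigr => j _; rewrite pairingN spowN mulrN.
Qed.

Lemma energyZ (t : R) f : energy (t *: f) = `|t| `^ p * energy f.
Proof.
rewrite /energy mulr_sumr; apply: eq_bigr => j _.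
by rewrite pairingZ normrM powRM // mulrCA.
Qed.

Lemma massZ (t : R) f : mass (t *: f) = `|t| `^ p * mass f.
Proof.
rewrite /mass mulr_sumr; apply: eq_bigr => i _.
by rewrite -[(t *: f) i]/(t * f i) normrM powRM // mulrCA.
Qed.

Lemma energyN f : energy (- f) = energy f.
Proof. by rewrite -scaleN1r energyZ normrN1 powR1 mul1r. Qed.

Lemma massN f : mass (- f) = mass f.
Proof. by rewrite -scaleN1r massZ normrN1 powR1 mul1r. Qed.

Lemma energy_ge0 f : 0 <= energy f.
Proof. by apply: sumr_ge0 => j _; rewrite mulr_ge0 ?powR_ge0. Qed.

Lemma mass_ge0 f : 0 <= mass f.
Proof. by apply: sumr_ge0 => j _; rewrite mulr_ge0 ?powR_ge0 // ltW. Qed.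

Lemma mass_gt0 f : f <> 0 -> 0 < mass f.
Proof.
move=> f0; have [i fi] : exists i, f i != 0.
  apply: contrapT => /forallNP H; apply: f0; apply/funext => i.
  by apply/eqP; move/negP: (H i); rewrite negbK.
rewrite /mass (bigD1 i) //= ltr_pwDl ?mulr_gt0 ?powR_gt0 ?normr_gt0 //.
by apply: sumr_ge0 => j _; rewrite mulr_ge0 ?powR_ge0 // ltW.
Qed.

Lemma rayleigh_ge0 f : 0 <= rayleigh f.
Proof. by rewrite divr_ge0 ?energy_ge0 ?mass_ge0. Qed.

Lemma rayleighZ (t : R) f : t != 0 -> rayleigh (t *: f) = rayleigh f.
Proof.
move=> t0; rewrite /rayleigh energyZ massZ -mulf_div divff ?mul1r //.
by rewrite gt_eqF //; apply: powR_gt0; rewrite normr_gt0.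
Qed.

(** * Continuity along an arbitrary map into the function space *)

Section Continuity.
Variables (T : topologicalType) (x : T) (h : T -> I -> R).
Hypothesis hc : forall i, {for x, continuous (fun y => h y i)}.

Lemma pairing_continuous j : {for x, continuous (fun y => pairing j (h y))}.
Proof.
apply: (@sum_continuous _ _ _ (fun i y => A j i * h y i)) => i.
by apply: cvgM; [exact: cvg_cst | exact: hc].
Qed.

Lemma energy_continuous : {for x, continuous (fun y => energy (h y))}.
Proof.
apply: (@sum_continuous _ _ _ (fun j y => a j * `|pairing j (h y)| `^ p)) => j.
apply: cvgM; first exact: cvg_cst.
apply: (@continuous_comp _ _ _ (fun y => pairing j (h y)) (fun r : R => `|r| `^ p)).
  exact: pairing_continuous.
exact: normr_powR_continuous.
Qed.

Lemma mass_continuous : {for x, continuous (fun y => mass (h y))}.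
Proof.
apply: (@sum_continuous _ _ _ (fun i y => w i * `|h y i| `^ p)) => i.
apply: cvgM; first exact: cvg_cst.
apply: (@continuous_comp _ _ _ (fun y => h y i) (fun r : R => `|r| `^ p)).
  exact: hc.
exact: normr_powR_continuous.
Qed.

Lemma gradient_continuous i : {for x, continuous (fun y => gradient i (h y))}.
Proof.
apply: (@sum_continuous _ _ _ (fun j y => a j * A j i * spow p (pairing j (h y)))) => j.
apply: cvgM; first exact: cvg_cst.
apply: (@continuous_comp _ _ _ (fun y => pairing j (h y)) (spow p : R -> R)).
  exact: pairing_continuous.
exact: spow_continuous.
Qed.

End Continuity.

Lemma energy_tangent f g :
  energy f + p * (\sum_i gradient i f * (g i - f i)) <= energy g.
Proof.
have -> : \sum_i gradient i f * (g i - f i) =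
    \sum_j a j * (spow p (pairing j f) * (pairing j g - pairing j f)).
  under eq_bigr do rewrite mulr_suml.
  rewrite exchange_big /=; apply: eq_bigr => j _.
  rewrite /pairing -sumrB !mulr_sumr; apply: eq_bigr => i _.
  by rewrite /pairing; ring.
rewrite /energy mulr_sumr -big_split /=; apply: ler_sum => j _.
rewrite mulrCA -mulrDr ler_wpM2l // mulrA.
exact: spow_tangent.
Qed.

Lemma mass_tangent f g :
  mass f + p * (\sum_i w i * spow p (f i) * (g i - f i)) <= mass g.
Proof.
rewrite /mass mulr_sumr -big_split /=; apply: ler_sum => i _.
rewrite -mulrA mulrCA -mulrDr ler_wpM2l ?(ltW (w_gt0 i)) // mulrA.
exact: spow_tangent.
Qed.

(** * One descent step for the energy minus [lam] times the mass *)

Section Descent.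
Variable lam : R.
Hypothesis lam_ge0 : 0 <= lam.

Definition residual i f : R := gradient i f - lam * (w i * spow p (f i)).
Definition descent (t : R) f : I -> R := fun i => f i - t * residual i f.
(** The gradient of the energy is taken after the step, that of the mass before it. At [t = 0] this
    is the sum of the squared residuals. *)
Definition gain f (t : R) : R :=
  \sum_i residual i f * (gradient i (descent t f) - lam * (w i * spow p (f i))).

Lemma residualN i f : residual i (- f) = - residual i f.
Proof.
by rewrite /residual gradientN -[(- f) i]/(- f i) spowN; ring.
Qed.

Lemma descentN t f : descent t (- f) = - descent t f.
Proof.
apply/funext => i; rewrite /descent residualN.
by rewrite -[(- f) i]/(- f i) -[RHS]/(- (f i - t * residual i f)); ring.
Qed.

(* Both tangent inequalities point the right way: that of [energy] is taken at
   the new point, that of [mass] at the old one. *)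
Lemma descent_gain t f : energy (descent t f) - lam * mass (descent t f) <=
  energy f - lam * mass f - p * t * gain f t.
Proof.
have E := energy_tangent (descent t f) f.
have M := ler_wpM2l lam_ge0 (mass_tangent f (descent t f)).
have -> : p * t * gain f t =
    p * (\sum_i gradient i (descent t f) * (f i - descent t f i)) +
    lam * (p * (\sum_i w i * spow p (f i) * (descent t f i - f i))).
  rewrite /gain !mulr_sumr -big_split /=; apply: eq_bigr => i _.
  set G := gradient i _; rewrite (_ : descent t f i = f i - t * residual i f) //.
  by ring.
lra.
Qed.

Lemma residual_continuous (T : topologicalType) (x : T) (h : T -> I -> R) i :
  (forall i, {for x, continuous (fun y => h y i)}) ->
  {for x, continuous (fun y => residual i (h y))}.
Proof.
move=> hc; apply: cvgB; first exact: gradient_continuous.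
apply: cvgM; first exact: cvg_cst; apply: cvgM; first exact: cvg_cst.
apply: (@continuous_comp _ _ _ (fun y => h y i) (spow p : R -> R)).
  exact: hc.
exact: spow_continuous.
Qed.

Lemma descent_continuous (T : topologicalType) (x : T) (h : T -> I -> R)
    (t : T -> R) i :
  (forall i, {for x, continuous (fun y => h y i)}) -> {for x, continuous t} ->
  {for x, continuous (fun y => descent (t y) (h y) i)}.
Proof.
move=> hc tc; apply: cvgB; first exact: hc.
by apply: cvgM; [exact: tc | exact: residual_continuous].
Qed.

Lemma gain_continuous (T : topologicalType) (x : T) (h : T -> I -> R)
    (t : T -> R) :
  (forall i, {for x, continuous (fun y => h y i)}) -> {for x, continuous t} ->
  {for x, continuous (fun y => gain (h y) (t y))}.
Proof.
move=> hc tc; apply: (@sum_continuous _ _ _ (fun i y => residual i (h y) *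
  (gradient i (descent (t y) (h y)) - lam * (w i * spow p (h y i))))) => i.
apply: cvgM; first exact: residual_continuous.
apply: cvgB.
  by apply: gradient_continuous => k; exact: descent_continuous.
apply: cvgM; first exact: cvg_cst; apply: cvgM; first exact: cvg_cst.
apply: (@continuous_comp _ _ _ (fun y => h y i) (spow p : R -> R)).
  exact: hc.
exact: spow_continuous.
Qed.

Lemma gain0_gt0 f : (exists i, residual i f != 0) -> 0 < gain f 0.
Proof.
move=> [i ri]; have -> : gain f 0 = \sum_i residual i f ^+ 2.
  apply: eq_bigr => k _; rewrite expr2; congr (_ * (gradient k _ - _)).
  by apply/funext => l; rewrite /descent mul0r subr0.
rewrite (bigD1 i) //= ltr_pwDl ?sumr_ge0 // => [|k _]; last exact: sqr_ge0.
by rewrite exprn_even_gt0.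
Qed.

End Descent.

Definition normalize f : I -> R := (norm1 f)^-1 *: f.

Lemma normalize_sphere1 f : f <> 0 -> sphere1 (normalize f).
Proof.
move=> /norm1_gt0 f0; rewrite /sphere1 /= norm1Z ger0_norm ?invr_ge0 ?norm1_ge0 //.
by rewrite mulVf // gt_eqF.
Qed.

Lemma normalizeN f : normalize (- f) = - normalize f.
Proof. by rewrite /normalize norm1N scalerN. Qed.

Lemma rayleigh_normalize f : f <> 0 -> rayleigh (normalize f) = rayleigh f.
Proof. by move=> /norm1_gt0 f0; rewrite rayleighZ // invr_eq0 gt_eqF. Qed.

Let mulV_continuous (T : topologicalType) (x : T) (q r : T -> R) :
  q x != 0 -> {for x, continuous q} -> {for x, continuous r} ->
  {for x, continuous (fun y => (q y)^-1 * r y)}.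
Proof. by move=> q0 qc rc; apply: cvgM => //; exact: cvgV. Qed.

Lemma normalize_continuous (f : {ptws I -> R}) i : f <> 0 ->
  {for f, continuous (fun g : {ptws I -> R} => normalize g i)}.
Proof.
move=> /norm1_gt0 f0.
apply: (@mulV_continuous _ f (@norm1 R I) (fun g : {ptws I -> R} => g i)).
- by rewrite gt_eqF.
- exact: norm1_continuous.
- exact: continuous_coord.
Qed.

(** By homogeneity only the l^1 sphere matters, where the energy is bounded above and the mass is
    bounded away from 0. *)
Lemma rayleigh_bounded : exists M : R, forall f, f <> 0 -> rayleigh f <= M.
Proof.
have [M M0 EM] := compact_upper_bound (@sphere1_compact R I)
  (fun f => energy_continuous (fun i => @continuous_coord R I i f)).
have [d d0 dM] := compact_positive_bound (@sphere1_compact R I)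
  (fun f => mass_continuous (fun i => @continuous_coord R I i f))
  (fun f Sf => mass_gt0 (sphere1_neq0 Sf)).
exists (M / d) => f f0; rewrite -rayleigh_normalize //.
have f1 := normalize_sphere1 f0.
rewrite /rayleigh ler_pM ?energy_ge0 ?invr_ge0 ?mass_ge0 ?EM //.
by rewrite lef_pV2 ?posrE ?dM // (lt_le_trans d0) // dM.
Qed.

Lemma eigenfunctionsE lam f : eigenfunctions p laplacian lam f <->
  f <> 0 /\ forall i, residual lam i f = 0.
Proof.
split=> -[f0 H]; split=> // i; have wi : w i != 0 by rewrite gt_eqF.
  apply/eqP; rewrite subr_eq0; apply/eqP.
  by rewrite mulrCA -(H i) /laplacian mulVKf.
move/eqP: (H i); rewrite subr_eq0 => /eqP; rewrite /laplacian => ->.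
by rewrite mulrCA mulKf.
Qed.

Lemma genus_gt0 (S : set (I -> R)) : (0 < genus S)%N -> S `\ (0 : I -> R) !=set0.
Proof. by rewrite /genus; case: asboolP. Qed.

(** Positive genus provides a nonzero point, so no supremum is taken over the empty set, where it
    would be -oo. *)
Lemma minmax_ge0 k : (0 < k)%N -> (0 <= minmax rayleigh k)%E.
Proof.
move=> k0; apply: le_ereal_inf_tmp => _ [S [_ Sk] <-].
have [f Sf] := genus_gt0 (leq_trans k0 Sk).
apply: (@le_trans _ _ (rayleigh f)%:E); first by rewrite lee_fin rayleigh_ge0.
by apply: ereal_sup_ubound; exists f.
Qed.

(** By Borsuk-Ulam the whole space is a competitor, and the quotient is bounded on it. *)
Lemma minmax_fin_num k : (0 < k <= #|I|)%N -> minmax rayleigh k \is a fin_num.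
Proof.
move=> /andP[k0 kI]; have [M HM] := rayleigh_bounded.
rewrite ge0_fin_numE; last exact: minmax_ge0.
apply: (@le_lt_trans _ _ M%:E); last exact: ltry.
apply: (@le_trans _ _ (ereal_sup [set (rayleigh f)%:E | f in [set: I -> R] `\ 0])).
  apply: ereal_inf_lbound; exists [set: I -> R] => //; split=> //.
  exact: leq_trans kI (card_le_genus_setT R I).
by apply: ge_ereal_sup => _ [f [_ f0] <-]; rewrite lee_fin HM.
Qed.

Lemma minmax_le k l : (k <= l)%N -> (minmax rayleigh k <= minmax rayleigh l)%E.
Proof.
move=> kl; apply: ereal_inf_le_tmp => _ [S [Ss Sl] <-]; exists S => //.
by split=> //; exact: leq_trans Sl.
Qed.

Lemma minmax_multiplicity k l lam : (0 < l)%N ->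
  (forall j, (k + 1 <= j <= k + l)%N -> minmax rayleigh j = lam%:E) ->
  (l <= genus (eigenfunctions p laplacian lam))%N.
Proof.
move=> l0 Hlam; rewrite leqNgt; apply/negP => Kl.
have Hk1 : minmax rayleigh k.+1 = lam%:E by apply: Hlam; rewrite addn1 leqnn -addn1 leq_add2l.
have Hkl : minmax rayleigh (k + l) = lam%:E by apply: Hlam; rewrite leq_add2l l0 leqnn.
have lam0 : 0 <= lam by rewrite -lee_fin -Hk1 minmax_ge0.
have Ksym : centrally_symmetric (eigenfunctions p laplacian lam).
  move=> f /eigenfunctionsE[f0 fr]; apply/eigenfunctionsE; split.
    by move/eqP; rewrite oppr_eq0 => /eqP.
  by move=> i; rewrite residualN fr oppr0.
have [u2 [u2l u2N u20]] : exists u : nat -> (I -> R) -> R,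
    [/\ forall j f g, `|u j f - u j g| <= 2 * norm1 (f - g),
        forall j f, u j (- f) = - u j f &
        forall f, eigenfunctions p laplacian lam f -> f <> 0 ->
          exists2 j, (j < l.-1)%N & u j f != 0].
  by apply: genus_extension => //; rewrite -ltnS prednK.
(* The common zeros of [u2], as the zero set of one continuous function; no eigenfunction for [lam]
   lies in it. *)
pose Z : set {ptws I -> R} := [set f | \sum_(j < l.-1) `|u2 j f| = 0].
have Zc : closed Z.
  have -> : Z = (fun f : {ptws I -> R} => \sum_(j < l.-1) `|u2 j f|) @^-1` [set 0] by [].
  apply: preimage_closed; last exact: closed_eq.
  move=> f _; apply: sum_continuous => j.
  apply: (@lipschitz_continuous _ _ _ 2) => g h.
  exact: le_trans (ler_dist_dist _ _) (u2l j g h).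
have ZP (f : I -> R) : ~ Z f -> exists2 j, (j < l.-1)%N & u2 j f != 0.
  move=> nZ; apply: contrapT => H; apply: nZ; rewrite /Z /= big1 // => j _.
  by apply/eqP; rewrite normr_eq0; apply/negPn/negP => uj; apply: H; exists j.
have Zr (f : I -> R) : f <> 0 -> Z f -> exists i, residual lam i f != 0.
  move=> f0 Zf; apply: contrapT => /forallNP H.
  have [|j jl] := u20 f _ f0.
    by apply/eigenfunctionsE; split=> // i; have /negP/negPn/eqP := H i.
  apply/negP/negPn; rewrite -normr_eq0; apply/eqP.
  have /psumr_eq0P : forall i : 'I_l.-1, true -> 0 <= `|u2 i f| by [].
  by move=> /(_ Zf (Ordinal jl)); exact.
pose C : set {ptws I -> R} := @sphere1 R I `&` Z.
have Cc : compact C by apply: compact_closedI => //; exact: sphere1_compact.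
have [t t0 gt] : exists2 t : R, 0 < t & forall f, C f -> 0 < gain lam f t.
  have [|f [f1 Zf]|t t0 H] :=
      @compact_uniform_step R _ C (fun z => gain lam z.1 z.2) Cc.
  - move=> z; apply: gain_continuous; last exact: cvg_snd.
    move=> i; apply: (@continuous_comp _ _ _ fst (fun f : {ptws I -> R} => f i)).
      exact: cvg_fst.
    exact: continuous_coord.
  - by apply: gain0_gt0; apply: Zr => //; exact: sphere1_neq0.
  - by exists t.
have [M1 M10 HM1] := compact_upper_bound (@sphere1_compact R I)
  (fun f => mass_continuous (fun i => @continuous_coord R I i f)).
have [d d0 dg] : exists2 d, 0 < d & forall f, C f -> d <= gain lam f t.
  apply: (@compact_positive_bound R {ptws I -> R} C (fun f => gain lam f t)) => // f.
  apply: gain_continuous; last exact: cst_continuous.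
  by move=> i; exact: continuous_coord.
have [M2 M20 HM2] : exists2 M, 0 < M &
    forall f, C f -> mass (descent lam t f) <= M.
  apply: (@compact_upper_bound R {ptws I -> R} C
    (fun f => mass (descent lam t f))) => // f.
  apply: mass_continuous => i; apply: descent_continuous; last exact: cst_continuous.
  by move=> i'; exact: continuous_coord.
pose D := p * t * d.
have D0 : 0 < D by rewrite !mulr_gt0.
(* [D] is the decrease guaranteed on [C]. As e (M1 + M2) = D/2, an excess of at most e M1 before the
   step becomes at most - e M2 - D/2 after it. *)
pose e := D / (2 * (M1 + M2)).
have e0 : 0 < e by rewrite divr_gt0 // mulr_gt0 // addr_gt0.
have eM : e * (M1 + M2) = D / 2.
  by rewrite /e; field; rewrite gt_eqF // addr_gt0.
pose S1 : set (I -> R) := [set g | g <> 0 /\ energy g <= (lam - e) * mass g].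
have S1sym : centrally_symmetric S1.
  move=> g [g0 gS]; split; first by move/eqP; rewrite oppr_eq0 => /eqP.
  by rewrite energyN massN.
(* Otherwise [S1] would compete for index k + 1 with supremum at most lam - e. *)
have S1k : (genus S1 <= k)%N.
  rewrite leqNgt; apply/negP => kS1.
  suff : (minmax rayleigh k.+1 <= (lam - e)%:E)%E.
    by rewrite Hk1 lee_fin; apply/negP; rewrite -ltNge gtrBl.
  apply: (@le_trans _ _ (ereal_sup [set (rayleigh f)%:E | f in S1 `\ (0 : I -> R)])).
    by apply: ereal_inf_lbound; exists S1.
  apply: ge_ereal_sup => _ [g [[g0 gS] _] <-].
  by rewrite lee_fin /rayleigh ler_pdivrMr // mass_gt0.
have [u1 [u1l u1N u10]] := genus_extension S1sym S1k.
have [_ [S [Ssym Sk] <-] Slt] : exists2 x, [set ereal_sup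
    [set (rayleigh f)%:E | f in S `\ (0 : I -> R)] | S in @Gen R I (k + l)] x &
    (x < lam%:E + e%:E)%E.
  by rewrite -Hkl; apply: lb_ereal_inf_adherent => //; rewrite -/(minmax _ _) Hkl.
have key f : S f -> f <> 0 -> Z (normalize f) -> S1 (descent lam t (normalize f)).
  move=> Sf f0 Zf; have f1 := normalize_sphere1 f0.
  have Cf : C (normalize f) by [].
  have Rf : energy (normalize f) <= (lam + e) * mass (normalize f).
    rewrite -ler_pdivrMr; last exact/mass_gt0/sphere1_neq0.
    rewrite -/(rayleigh _) rayleigh_normalize // -lee_fin EFinD.
    by apply: le_trans (ltW Slt); apply: ereal_sup_ubound; exists f.
  have dd := descent_gain lam0 t (normalize f).
  have m1 := HM1 _ f1; have m2 := HM2 _ Cf; have g1 := dg _ Cf.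
  have m20 := mass_ge0 (descent lam t (normalize f)).
  have pt : p * t * d <= p * t * gain lam (normalize f) t.
    by rewrite ler_pM2l // mulr_gt0.
  have em1 : e * mass (normalize f) <= e * M1 by rewrite ler_pM2l.
  have em2 : e * mass (descent lam t (normalize f)) <= e * M2 by rewrite ler_pM2l.
  rewrite -/D in pt; split; last by rewrite mulrBl; lra.
  (* The step cannot land at 0: both energies vanish there, while their difference after the step is
     at most e M1 - D < 0. *)
  move=> dE; move: dd; rewrite dE.
  have -> : energy 0 = 0 by rewrite -[0 in LHS](scale0r 0) energyZ normr0 powR0 ?mul0r ?gt_eqF.
  have -> : mass 0 = 0 by rewrite -[0 in LHS](scale0r 0) massZ normr0 powR0 ?mul0r ?gt_eqF.
  rewrite mulr0 subr0; nra.
suff : (genus S <= k + l.-1)%N.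
  by apply/negP; rewrite -ltnNge (leq_trans _ Sk) // ltn_add2l prednK.
(* The first [k] functions test the point after the descent step, the other l - 1 test the point
   before it; where the latter all vanish, the step lands in [S1] and some [u1 j] is nonzero. *)
apply: (genus_le (u := fun j (f : {ptws I -> R}) =>
  if (j < k)%N then u1 j (descent lam t (normalize f))
  else u2 (j - k)%N (normalize f))).
- move=> j f f0; case: (j < k)%N.
    apply: (lipschitz_comp_continuous _ (u1l j)) => i.
    apply: descent_continuous; last exact: cst_continuous.
    by move=> i'; exact: normalize_continuous.
  apply: (lipschitz_comp_continuous _ (u2l _)) => i.
  exact: normalize_continuous.
- by move=> j f; case: ifP => _; rewrite normalizeN ?descentN ?u1N ?u2N.
- move=> f Sf f0; have [Zf|/ZP[j jl uj]] := pselect (Z (normalize f)).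
    have [S1f gf] := key f Sf f0 Zf.
    have [j jk uj] := u10 _ (conj S1f gf) S1f.
    by exists j; [exact: leq_trans jk (leq_addr _ _) | rewrite jk].
  exists (k + j)%N; first by rewrite ltn_add2l.
  by rewrite ltnNge leq_addr /= addKn.
Qed.

Theorem minmax_principle :
  [/\ forall k, (1 <= k <= #|I|)%N -> exists lam : R,
         minmax rayleigh k = lam%:E /\ is_eigenvalue p laplacian lam,
      forall k l, (1 <= k)%N -> (k <= l)%N -> (l <= #|I|)%N ->
        (minmax rayleigh k <= minmax rayleigh l)%E &
      forall k l lam, (k < k + l)%N -> (k + l <= #|I|)%N ->
        (forall j, (k + 1 <= j <= k + l)%N -> minmax rayleigh j = lam%:E) ->
        (l <= genus (eigenfunctions p laplacian lam))%N].
Proof.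
split.
- move=> [|k] // kI; exists (fine (minmax rayleigh k.+1)).
  have kE := fineK (minmax_fin_num kI); split=> //.
  (* Multiplicity with l = 1: positive genus yields an eigenfunction. *)
  have : (1 <= genus (eigenfunctions p laplacian (fine (minmax rayleigh k.+1))))%N.
    apply: (@minmax_multiplicity k) => // j; rewrite !addn1 -eqn_leq => /eqP <-.
    by rewrite kE.
  by move=> /genus_gt0[f [Kf _]]; exists f.
- by move=> k l _ kl _; exact: minmax_le.
- move=> k l lam; rewrite -[X in (X < _)%N]addn0 ltn_add2l => l0 _.
  exact: minmax_multiplicity.
Qed.

End MinMax.

(** * Hypergraph Laplacians *)

Section Hypergraph.
Variables (R : realType) (V : finType) (G : hypergraph V).
Implicit Types (h : edge G) (i : V).

(** [hin h] and [hout h] are disjoint, so the order of the tests in [incidence] does not matter. *)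
Lemma incidenceE h i :
  incidence R h i = (i \in hin h)%:R - (i \in hout h)%:R.
Proof.
rewrite /incidence; case: ifP => [ih|_]; last by case: ifP; rewrite ?subr0 ?sub0r.
case oh: (i \in hout h); last by rewrite subr0.
have := hedges_disjoint (valP h) => /setP/(_ i).
by rewrite !inE -/(hin h) -/(hout h) ih oh.
Qed.

Lemma incidence_eq0 h i : i \notin hsupp h -> incidence R h i = 0.
Proof.
rewrite inE negb_or incidenceE => /andP[/negbTE -> /negbTE ->].
by rewrite subrr.
Qed.

Lemma edge_pairingE h (f : V -> R) :
  edge_pairing h f = pairing (@incidence R V G) h f.
Proof.
rewrite /edge_pairing /pairing !(big_mkcond (fun i => i \in _)) -sumrB.
apply: eq_bigr => i _; rewrite incidenceE mulrBl.
by do 2!case: (i \in _); rewrite ?mul1r ?mul0r.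
Qed.

Lemma vertex_pairingE i (g : edge G -> R) :
  vertex_pairing i g = pairing (fun i h => incidence R h i) i g.
Proof.
rewrite /vertex_pairing /pairing big_mkcond [X in _ - X]big_mkcond -sumrB.
apply: eq_bigr => h _; rewrite incidenceE mulrBl.
by do 2!case: (i \in _); rewrite ?mul1r ?mul0r.
Qed.

Variable p : R.

Lemma vertex_RQE : @vertex_RQ R V G p =
  rayleigh p (@incidence R V G) (fun=> 1) (fun i => (deg G i)%:R).
Proof.
apply/funext => f; rewrite /vertex_RQ; congr (_ / _).
by apply: eq_bigr => h _; rewrite mul1r edge_pairingE.
Qed.

Lemma vertex_laplacianE : @vertex_laplacian R V G p =
  laplacian p (@incidence R V G) (fun=> 1) (fun i => (deg G i)%:R).
Proof.
apply/funext => f; apply/funext => i; rewrite /vertex_laplacian; congr (_ * _).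
rewrite big_mkcond; apply: eq_bigr => h _; rewrite mul1r edge_pairingE.
by case: ifPn => // /incidence_eq0 ->; rewrite mul0r.
Qed.

(** Vertices and hyperedges trade places: the incidence matrix is transposed, and the degrees move,
    inverted, from the mass to the energy. *)
Lemma edge_RQE : @edge_RQ R V G p =
  rayleigh p (fun i h => incidence R h i) (fun i => (deg G i)%:R^-1) (fun=> 1).
Proof.
apply/funext => g; rewrite /edge_RQ; congr (_ / _).
  by apply: eq_bigr => i _; rewrite vertex_pairingE.
by apply: eq_bigr => h _; rewrite mul1r.
Qed.

Lemma edge_laplacianE : @edge_laplacian R V G p =
  laplacian p (fun i h => incidence R h i) (fun i => (deg G i)%:R^-1) (fun=> 1).
Proof.
apply/funext => g; apply/funext => h; rewrite /edge_laplacian /laplacian invr1 mul1r.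
rewrite big_mkcond; apply: eq_bigr => i _; rewrite vertex_pairingE.
by case: ifPn => // /incidence_eq0 ->; rewrite mulr0 mul0r.
Qed.

End Hypergraph.

Theorem theorem2p12 (R : realType) (V : finType) (G : hypergraph V) (p : R)
    (hdeg : forall i : V, (1 <= deg G i)%N) (hp : 1 < p) :
  [/\ (forall k : nat, (1 <= k <= #|V|)%N ->
         exists lam : R,
           lambda_ G p k = lam%:E /\
           is_eigenvalue p (@vertex_laplacian R V G p) lam),
      (forall i j : nat, (1 <= i)%N -> (i <= j)%N -> (j <= #|V|)%N ->
         (lambda_ G p i <= lambda_ G p j)%E) &
      (forall (k l : nat) (lam : R), (k < k + l)%N -> (k + l <= #|V|)%N ->
         (forall j : nat, (k + 1 <= j <= k + l)%N -> lambda_ G p j = lam%:E) ->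
         (l <= genus (eigenfunctions p (@vertex_laplacian R V G p) lam))%N)]
  /\
  [/\ (forall k : nat, (1 <= k <= #|hedges G|)%N ->
         exists mu : R,
           mu_ G p k = mu%:E /\
           is_eigenvalue p (@edge_laplacian R V G p) mu),
      (forall i j : nat, (1 <= i)%N -> (i <= j)%N -> (j <= #|hedges G|)%N ->
         (mu_ G p i <= mu_ G p j)%E) &
      (forall (k l : nat) (mu : R), (k < k + l)%N -> (k + l <= #|hedges G|)%N ->
         (forall j : nat, (k + 1 <= j <= k + l)%N -> mu_ G p j = mu%:E) ->
         (l <= genus (eigenfunctions p (@edge_laplacian R V G p) mu))%N)].
Proof.
have w0 i : 0 < (deg G i)%:R :> R by rewrite ltr0n.
rewrite /lambda_ /mu_ vertex_RQE vertex_laplacianE edge_RQE edge_laplacianE.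
(* The abstract principle counts the elements of the type [edge G], the statement those of the set
   [hedges G]. *)
have -> : #|hedges G| = #|edge G| by rewrite card_sig.
by split; apply: minmax_principle.
Qed.
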